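(* Let $Q$ be a local (or graded) ring, commutative and Noetherian and an algebra over a field $k$, and let $\underline{g}=g_1,\dots,g_s$ be a (homogeneous) regular sequence in $Q$. (1) Every finitely generated $\underline{g}$-weak complete intersection module has finite projective dimension. (2) A weak complete intersection ideal is a $\underline{g}$-weak complete intersection ideal if and only if it is a complete intersection ideal embedded in $(\underline{g})$.
   Context: A finitely generated $Q$-module $M$ is a $\underline{g}$-weak complete intersection module if there is a free resolution $(F,\partial)$ of $M$ over $Q$ such that $\mathrm{Im}\,\partial_i\subseteq(\underline{g})F_{i-1}$ for every $i$. An ideal $I\subseteq Q$ is a $\underline{g}$-weak complete intersection ideal if $Q/I$ is a $\underline{g}$-weak complete intersection module. An ideal $I\subseteq Q$ is a weak complete intersection ideal if the differentials in the minimal free resolution $F$ of $Q/I$ over $Q$ land in $IF$. A complete intersection ideal is an ideal generated by a regular sequence; it is embedded in $(\underline{g})$ if it is contained in $(\underline{g})$. *)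

(* Defs.v *)
From HB Require Import structures.
From mathcomp Require Import all_boot all_order all_algebra.
From mathcomp Require Import classical_sets.

Set Implicit Arguments.
Unset Strict Implicit.
Unset Printing Implicit Defensive.

Import GRing.Theory.
Local Open Scope ring_scope.
Local Open Scope classical_set_scope.
Local Open Scope quotient_scope.

(* Ideals are the library's [idealr R]: over a commutative ring these are the
   ideals, and they are PROPER by definition (1 \notin I).  Their boolean
   membership is no restriction in the classical setting.  Sets which need not
   be proper or are not known to be decidable are of type [set R]. *)

(* Q/I as a Q-module, extending the library's quotient ring {ideal_quot I}. *)
Section QuotientModule.
Variables (R : comNzRingType) (I : idealr R).

Definition quot_scale (a : R) (x : {ideal_quot I}) : {ideal_quot I} :=
  \pi_{ideal_quot I} a * x.

Fact quot_scaleA a b x : quot_scale a (quot_scale b x) = quot_scale (a * b) x.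
Proof. by rewrite /quot_scale mulrA -rmorphM. Qed.

Fact quot_scale1 : left_id 1 quot_scale.
Proof. by move=> x; rewrite /quot_scale rmorph1 mul1r. Qed.

Fact quot_scaleDr : right_distributive quot_scale +%R.
Proof. by move=> a x y; rewrite /quot_scale mulrDr. Qed.

Fact quot_scaleDl x : {morph quot_scale^~ x : a b / a + b}.
Proof. by move=> a b; rewrite /quot_scale rmorphD mulrDl. Qed.

HB.instance Definition _ := GRing.Zmodule_isLmodule.Build R {ideal_quot I}
  quot_scaleA quot_scale1 quot_scaleDr quot_scaleDl.

End QuotientModule.

Section Rings.
Variable R : comNzRingType.

Definition ideal_gen (s : seq R) : set R :=
  [set x | exists c : nat -> R, x = \sum_(i < size s) c i * s`_i].

Definition noetherian_ring : Prop :=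
  forall I : idealr R, exists s : seq R, [set` I] = ideal_gen s.

Definition maximal_ideal (m : idealr R) : Prop :=
  forall J : idealr R, {subset m <= J} -> J =i m.

(* (R, m) is local: m is the unique maximal ideal. *)
Definition local_ring (m : idealr R) : Prop :=
  maximal_ideal m /\ forall m' : idealr R, maximal_ideal m' -> m' =i m.

Definition regular_sequence (s : seq R) : Prop :=
  (forall i, (i < size s)%N -> forall x,
      ideal_gen (take i s) (s`_i * x) -> ideal_gen (take i s) x)
  /\ ~ ideal_gen s 1.

Definition complete_intersection_ideal (I : idealr R) : Prop :=
  exists f : seq R, regular_sequence f /\ [set` I] = ideal_gen f.

End Rings.

Section Modules.
Variable R : comNzRingType.
Implicit Types V M P : lmodType R.

Definition fin_gen V : Prop :=
  exists s : seq V, forall v, exists c : V -> R, v = \sum_(x <- s) c x *: x.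

(* Bases may be infinite. *)
Definition is_basis V (B : set V) : Prop :=
  (forall v, exists (s : seq V) (c : V -> R),
      [set` s] `<=` B /\ v = \sum_(x <- s) c x *: x)
  /\ (forall (s : seq V) (c : V -> R), uniq s -> [set` s] `<=` B ->
        \sum_(x <- s) c x *: x = 0 -> forall x, x \in s -> c x = 0).

Definition free_module V : Prop := exists B : set V, is_basis B.

Definition projective_module P : Prop :=
  forall (A C : lmodType R) (p : {linear A -> C}) (h : {linear P -> C}),
    (forall z, exists y, p y = z) ->
    exists h' : {linear P -> A}, forall x, p (h' x) = h x.

(* The submodule J V, for J a subset of R. *)
Definition smul_set (J : set R) V : set V :=
  [set v | exists s : seq (R * V),
     (forall p, p \in s -> J p.1) /\ v = \sum_(p <- s) p.1 *: p.2].

(* An exact complex ... -> F 1 -> F 0 -> M -> 0; [res_diff F i] is the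
   differential from F (i+1) to F i. *)
Record resolution M := Resolution {
  res_mod :> nat -> lmodType R;
  res_diff : forall i, {linear res_mod i.+1 -> res_mod i};
  res_aug : {linear res_mod 0%N -> M};
  res_aug_surj : forall y, exists x, res_aug x = y;
  res_exact0 : forall x, res_aug x = 0 <-> exists y, res_diff 0%N y = x;
  res_exact : forall i x,
    res_diff i x = 0 <-> exists y, res_diff i.+1 y = x
}.

Definition free_resolution M (F : resolution M) : Prop :=
  forall i, free_module (F i).

Definition finite_proj_dim M : Prop :=
  exists (P : resolution M) (n : nat),
    (forall i, projective_module (P i)) /\
    (forall i, (n < i)%N -> forall x : P i, x = 0).

Definition diff_lands_in (J : set R) M (F : resolution M) : Prop :=
  forall i (x : F i.+1), smul_set J (res_diff F i x).

(* [m] is the (homogeneous) maximal ideal. *)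
Definition minimal_free_resolution (m : idealr R) M (F : resolution M) : Prop :=
  (forall i, free_module (F i) /\ fin_gen (F i)) /\ diff_lands_in [set` m] F.

Definition g_weak_ci_module (g : seq R) M : Prop :=
  exists F : resolution M,
    free_resolution F /\ diff_lands_in (ideal_gen g) F.

Definition g_weak_ci_ideal (g : seq R) (I : idealr R) : Prop :=
  g_weak_ci_module g {ideal_quot I}.

Definition weak_ci_ideal (m I : idealr R) : Prop :=
  exists F : resolution {ideal_quot I},
    minimal_free_resolution m F /\ diff_lands_in [set` I] F.

End Modules.

(* The graded analogues: gradings are by the integers, graded maps have
   degree 0. *)

Section Gradings.

(* V is the internal direct sum of the subgroups G i. *)
Definition grading (V : zmodType) (G : int -> set V) : Prop :=
  [/\ forall i, G i 0 /\ (forall x y, G i x -> G i y -> G i (x - y)),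
      forall x, exists (s : seq int) (c : int -> V),
        (forall i, G i (c i)) /\ x = \sum_(i <- s) c i
    & forall (s : seq int) (c : int -> V), uniq s -> (forall i, G i (c i)) ->
        \sum_(i <- s) c i = 0 -> forall i, i \in s -> c i = 0].

Definition homogeneous (V : zmodType) (G : int -> set V) : set V :=
  [set x | exists i, G i x].

(* A grading of the k-algebra Q; k (hence 1) sits in degree 0. *)
Definition algebra_grading (k : fieldType) (Q : comAlgType k)
    (G : int -> set Q) : Prop :=
  [/\ grading G,
      forall i j x y, G i x -> G j y -> G (i + j) (x * y)
    & forall a : k, G 0 a%:A].

Variables (R : comNzRingType) (G : int -> set R).
Implicit Types M : lmodType R.

Definition module_grading M (GM : int -> set M) : Prop :=
  grading GM /\ forall i j a x, G i a -> GM j x -> GM (i + j) (a *: x).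

Definition homogeneous_ideal (I : idealr R) : Prop :=
  forall x, x \in I -> exists (s : seq int) (c : int -> R),
    (forall i, G i (c i) /\ c i \in I) /\ x = \sum_(i <- s) c i.

Definition maximal_homogeneous_ideal (m : idealr R) : Prop :=
  homogeneous_ideal m /\
  forall J : idealr R, homogeneous_ideal J -> {subset m <= J} -> J =i m.

(* m is the unique maximal homogeneous ideal; e.g. the ideal of the elements
   of positive degree when R is nonnegatively graded with R_0 a field. *)
Definition graded_local_ring (m : idealr R) : Prop :=
  maximal_homogeneous_ideal m /\
  forall m' : idealr R, maximal_homogeneous_ideal m' -> m' =i m.

Definition quot_grading (I : idealr R) (i : int) : set {ideal_quot I} :=
  [set \pi_{ideal_quot I} x | x in G i].
Arguments quot_grading : clear implicits.

Definition graded_complete_intersection_ideal (I : idealr R) : Prop :=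
  exists f : seq R, [/\ regular_sequence f, [set` f] `<=` homogeneous G
                      & [set` I] = ideal_gen f].

Definition graded_free_resolution M (GM : int -> set M) (F : resolution M) :
    Prop :=
  exists GF : forall i, int -> set (F i),
    [/\ forall i, module_grading (GF i),
        forall i, exists B : set (F i),
          is_basis B /\ B `<=` homogeneous (GF i),
        forall i j x, GF i.+1 j x -> GF i j (res_diff F i x)
      & forall j x, GF 0%N j x -> GM j (res_aug F x)].

Definition graded_g_weak_ci_module (g : seq R) M (GM : int -> set M) : Prop :=
  exists F : resolution M,
    graded_free_resolution GM F /\ diff_lands_in (ideal_gen g) F.

Definition graded_g_weak_ci_ideal (g : seq R) (I : idealr R) : Prop :=
  graded_g_weak_ci_module g (quot_grading I).

Definition graded_weak_ci_ideal (m I : idealr R) : Prop :=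
  exists F : resolution {ideal_quot I},
    [/\ graded_free_resolution (quot_grading I) F,
        minimal_free_resolution m F
      & diff_lands_in [set` I] F].

End Gradings.

Arguments quot_grading {R} G I i.

(* Main.v *)
Require Import Defs.
From HB Require Import structures.
From mathcomp Require Import all_boot all_order all_algebra.
From mathcomp Require Import boolp classical_sets.
From mathcomp Require Import ring.

(** Let F be a free resolution of M with dF in (g)F.  Since the g_i form a
    regular sequence, R/(g) has a Koszul resolution of length s, the number of
    the g_i; hence Tor_i(M, R/(g)) = 0 for i > s.  But F/(g)F has zero
    differential, so this Tor is F_i/(g)F_i, and a free module with
    F_i = (g)F_i vanishes.  Thus F itself is finite, which proves (1)
    (g_weak_vanishing).  No Koszul complex is formed: exactness of F/JF in
    large degrees is carried from J to J + (a) at the cost of one degree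
    (exact_mod_adjoin).

    For (2), let F be the minimal resolution of R/I, with dF in IF.  If I is in
    (g), then F shows that I is a g-weak complete intersection ideal.
    Conversely, any free resolution of R/I with differentials in (g) forces
    I to be in (g) (diff_lands_in_sub), so (1) applies to F and F has a finite
    length p.  Three facts about F then give a regular sequence.

    - I has depth at least p: the last differential has its entries in I and
      remains injective modulo a regular sequence t in I of length less than p,
      so no nonzero element of R/(t) is killed by I (depth_resolution).

    - The number n of generators of I, which is the rank of F_1, is at most p:
      composing the null-homotopies of the multiplications by the generators
      yields an element of F_n outside IF_n (homotopy_chain).

    - An ideal with n generators f_1, ..., f_n and of depth at least n is
      generated by a regular sequence x_1, ..., x_n, where x_i is f_i plus a
      combination of the later f_j, chosen by prime avoidance for the finitely
      many maximal annihilators of nonzero elements (coset_avoidance,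
      regular_generators).

    In the graded case the x_i need not be homogeneous, so it must be shown
    that the homogeneous f_i themselves form a regular sequence.  After
    localization at 1 + I they do, in the reverse order, as there regular
    sequences can be permuted.  A relation u y in J, with u in 1 + I and J and
    y homogeneous, holds with u replaced by its component of degree 0, which is
    a unit since I is in the maximal homogeneous ideal; so the localization is
    harmless (locally_regular_homogeneous). *)

Set Implicit Arguments.
Unset Strict Implicit.
Unset Printing Implicit Defensive.

Import GRing.Theory.
Local Open Scope ring_scope.
Local Open Scope classical_set_scope.
Local Open Scope quotient_scope.

(** * Ideals and regular sequences *)

Section Ideals.
Variable R : comNzRingType.
Implicit Types (A J : set R) (a b x y : R) (s : seq R).

Definition is_ideal J := J 0 /\ forall a x y, J x -> J y -> J (a * x + y).

Lemma ideal0 J : is_ideal J -> J 0. Proof. by case. Qed.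

Lemma idealD J x y : is_ideal J -> J x -> J y -> J (x + y).
Proof. by case=> _ cJ Jx Jy; rewrite -[x]mul1r; apply: cJ. Qed.

Lemma idealM J a x : is_ideal J -> J x -> J (a * x).
Proof. by case=> J0 cJ Jx; rewrite -[_ * _]addr0; apply: cJ. Qed.

Lemma idealN J x : is_ideal J -> J x -> J (- x).
Proof. by move=> iJ Jx; rewrite -mulN1r; apply: idealM. Qed.

Lemma idealB J x y : is_ideal J -> J x -> J y -> J (x - y).
Proof. by move=> iJ Jx Jy; apply: idealD => //; apply: idealN. Qed.

Lemma ideal_sum J (T : eqType) (r : seq T) (f : T -> R) :
  is_ideal J -> (forall i, i \in r -> J (f i)) -> J (\sum_(i <- r) f i).
Proof.
move=> iJ Jf; rewrite big_seq; elim/big_rec: _ => [|i x ir Jx].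
  exact: ideal0.
by apply: idealD => //; apply: Jf.
Qed.

Lemma is_ideal_idealr (I : idealr R) : is_ideal [set` I].
Proof. by split=> [|a x y Ix Iy] /=; rewrite ?idealr0 ?rpredD ?idealMr. Qed.

Lemma idealr_of_set J : is_ideal J -> ~ J 1 ->
  exists I : idealr R, [set` I] = J.
Proof.
move=> iJ J1; pose S : {pred R} := fun x => `[< J x >].
have cS : idealr_closed S.
  split; first by apply/asboolP; exact: ideal0.
    by apply/negP => /asboolP.
  by move=> a x y /asboolP Jx /asboolP Jy; apply/asboolP; apply: iJ.2.
pose ZM := GRing.isZmodClosed.Build R S (idealr_closedB cS).
pose PM := isProperIdeal.Build R S (idealr_closed_nontrivial cS).
pose I : idealr R := HB.pack S ZM PM.
by exists I; apply/seteqP; split=> x /asboolP.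
Qed.

(** The ideal J + (a).  Adjoining the members of a sequence one at a time, by
    a fold, lets every statement on sequences be proved by induction over an
    arbitrary base ideal, which stands for passing to a quotient ring. *)
Definition adjoin J a : set R := [set x | exists c, J (x - c * a)].

Lemma adjoin_ideal J a : is_ideal J -> is_ideal (adjoin J a).
Proof.
move=> iJ; split=> [|b x y [c Jc] [d Jd]].
  by exists 0; rewrite mul0r subr0; apply: ideal0.
exists (b * c + d).
by rewrite (_ : _ - _ = b * (x - c * a) + (y - d * a)); [apply: iJ.2|ring].
Qed.

Lemma adjoin_sub J a : is_ideal J -> J `<=` adjoin J a.
Proof. by move=> iJ x Jx; exists 0; rewrite mul0r subr0. Qed.

Lemma adjoin_mem J a c : is_ideal J -> adjoin J a (c * a).
Proof. by move=> iJ; exists c; rewrite subrr; apply: ideal0. Qed.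

Lemma adjoin_self J a : is_ideal J -> adjoin J a a.
Proof. by move=> iJ; rewrite -{2}[a]mul1r; apply: adjoin_mem. Qed.

Lemma adjoin_min J K a : is_ideal K -> J `<=` K -> K a -> adjoin J a `<=` K.
Proof.
move=> iK JK Ka x [c /JK Kx]; rewrite -(subrK (c * a) x).
by apply: idealD => //; apply: idealM.
Qed.

Definition adjoins J s : set R := foldl adjoin J s.

Lemma adjoins_ideal J s : is_ideal J -> is_ideal (adjoins J s).
Proof. by elim: s J => [|a s IH] J iJ //=; apply/IH/adjoin_ideal. Qed.

Lemma adjoins_sub J s : is_ideal J -> J `<=` adjoins J s.
Proof.
elim: s J => [|a s IH] J iJ //= x Jx; apply: IH; first exact: adjoin_ideal.
exact: adjoin_sub.
Qed.

Lemma adjoins_mem J s a : is_ideal J -> a \in s -> adjoins J s a.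
Proof.
elim: s J => [|b s IH] J iJ //=; rewrite inE => /orP[/eqP->|]; last first.
  exact/IH/adjoin_ideal.
by apply: adjoins_sub; [exact: adjoin_ideal|exact: adjoin_self].
Qed.

Lemma adjoins_min J K s : is_ideal K -> J `<=` K -> [set` s] `<=` K ->
  adjoins J s `<=` K.
Proof.
move=> iK; elim: s J => [//|a s IH] J JK sK; apply: IH.
  by apply: adjoin_min => //; apply: sK; rewrite /= inE eqxx.
by move=> x xs; apply: sK; rewrite /= inE xs orbT.
Qed.

Lemma is_ideal_zero : is_ideal [set 0].
Proof. by split=> // a x y /= -> ->; rewrite mulr0 addr0. Qed.

Lemma ideal_gen_is_ideal s : is_ideal (ideal_gen s).
Proof.
split=> [|a x y [c ->] [d ->]].
  by exists (fun=> 0); rewrite big1 // => i _; rewrite mul0r.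
exists (fun i => a * c i + d i); rewrite mulr_sumr -big_split /=.
by apply: eq_bigr => i _; rewrite mulrDl mulrA.
Qed.

Lemma ideal_gen_mem s x : x \in s -> ideal_gen s x.
Proof.
move=> xs; exists (fun i => (i == index x s)%:R).
have lt_i : (index x s < size s)%N by rewrite index_mem.
rewrite (bigD1 (Ordinal lt_i)) //= eqxx mul1r nth_index // big1 ?addr0 // => i.
by rewrite -val_eqE /= => /negPf->; rewrite mul0r.
Qed.

Lemma ideal_gen_min K s : is_ideal K -> [set` s] `<=` K -> ideal_gen s `<=` K.
Proof.
move=> iK sK _ [c ->]; apply: ideal_sum => // i _; apply: idealM => //.
by apply: sK; rewrite /= mem_nth.
Qed.

Lemma ideal_genE s : ideal_gen s = adjoins [set 0] s.
Proof.
apply/seteqP; split.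
  apply: ideal_gen_min; first exact/adjoins_ideal/is_ideal_zero.
  by move=> x /= xs; apply: adjoins_mem => //; apply: is_ideal_zero.
apply: adjoins_min; first exact: ideal_gen_is_ideal.
  by move=> _ ->; apply: ideal0; exact: ideal_gen_is_ideal.
exact: ideal_gen_mem.
Qed.

Definition nzd_mod J a := forall x, J (a * x) -> J x.

(** A regular sequence on R/J, without the condition that it generates a
    proper ideal. *)
Fixpoint regular_mod J s : Prop :=
  if s is a :: s' then nzd_mod J a /\ regular_mod (adjoin J a) s' else True.

Lemma regular_modP J s : regular_mod J s <->
  forall i, (i < size s)%N -> nzd_mod (adjoins J (take i s)) s`_i.
Proof.
elim: s J => [|a s IH] J /=; first by split.
split=> [[ra /IH rs] [|i] //= lt_i|rs]; first exact: rs.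
by split; [exact: (rs 0%N)|apply/IH => i lt_i; exact: (rs i.+1)].
Qed.

Lemma regular_mod_cat J s t :
  regular_mod J (s ++ t) <-> regular_mod J s /\ regular_mod (adjoins J s) t.
Proof.
elim: s J => [|a s IH] J /=; first by split=> // -[].
by split=> [[? /IH[]]|[[? ?] ?]] //; split=> //; apply/IH.
Qed.

Lemma regular_sequenceE s :
  regular_sequence s <-> regular_mod [set 0] s /\ ~ ideal_gen s 1.
Proof.
split=> -[rs s1]; split=> //.
  by apply/regular_modP => i lt_i x; rewrite -ideal_genE; apply: rs.
by move: rs => /regular_modP rs i lt_i x; rewrite ideal_genE; apply: rs.
Qed.

End Ideals.

(** * Noetherian rings and avoidance of zero divisors *)

Section Noetherian.
Variable R : comNzRingType.
Hypothesis noethR : noetherian_ring R.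
Implicit Types (A J : set R) (a b x y : R) (s : seq R).

Lemma noetherian_fg A : is_ideal A -> exists s, A = ideal_gen s.
Proof.
move=> iA; have [A1|A1] := pselect (A 1); last first.
  by have [I <-] := idealr_of_set iA A1; apply: noethR.
exists [:: 1]; apply/seteqP; split=> [x _|]; last first.
  by apply: ideal_gen_min => // x /=; rewrite inE => /eqP->.
rewrite -[x]mulr1; apply: idealM; first exact: ideal_gen_is_ideal.
by apply: ideal_gen_mem; rewrite inE.
Qed.

(** The maximum principle.  In Zorn's lemma the union of a chain is finitely
    generated, hence equal to one of its members; the empty set is thrown in
    only because it is the union of the empty chain. *)
Lemma noetherian_max (P : set (set R)) A0 :
  (forall A, P A -> is_ideal A) -> P A0 ->
  exists A, [/\ P A, A0 `<=` A & forall B, P B -> A `<=` B -> B = A].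
Proof.
move=> Pid PA0; pose P' A := A = set0 \/ P A /\ A0 `<=` A.
have [F FP Ftot|A [PA maxA]] := @Zorn_bigcup _ P'.
  have [[X0 [FX0 nX0]]|allE] := pselect (exists X, F X /\ X <> set0); last first.
    left; apply/seteqP; split=> // x [X FX Xx]; apply: allE.
    by exists X; split=> // XE; rewrite XE in Xx.
  right; have PX X : F X -> X <> set0 -> P X /\ A0 `<=` X.
    by move=> /FP[].
  pose U := \bigcup_(X in F) X.
  have [PX0 sX0] := PX _ FX0 nX0.
  have memE X x : F X -> X x -> X <> set0 by move=> _ Xx XE; rewrite XE in Xx.
  have iU : is_ideal U.
    split; first by exists X0 => //; apply: ideal0; exact: Pid.
    move=> a x y [X FX Xx] [Y FY Yy].
    have iX := Pid _ (PX _ FX (memE _ _ FX Xx)).1.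
    have iY := Pid _ (PX _ FY (memE _ _ FY Yy)).1.
    case: (Ftot _ _ FX FY) => [XY|YX].
      by exists Y => //; apply: iY.2 => //; apply: XY.
    by exists X => //; apply: iX.2 => //; apply: YX.
  have [s Us] := noetherian_fg iU.
  have [X [FX nX sX]] : exists X, [/\ F X, X <> set0 & [set` s] `<=` X].
    have: [set` s] `<=` U by rewrite Us => x /=; apply: ideal_gen_mem.
    elim: (s) => [|x t IH] sU; first by exists X0; split.
    have [|X [FX nX tX]] := IH.
      by move=> z zt; apply: sU; rewrite /= inE [_ \in t]zt orbT.
    have [|Y FY Yx] := sU x; first by rewrite /= inE eqxx.
    case: (Ftot _ _ FX FY) => [XY|YX].
      exists Y; split=> //; first exact: memE Yx.
      by move=> z /=; rewrite inE => /orP[/eqP->//|/tX/XY].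
    exists X; split=> // z /=; rewrite inE => /orP[/eqP->|/tX//].
    exact: YX.
  suff -> : \bigcup_(X in F) X = X by apply: PX.
  apply/seteqP; split=> [|x Xx]; last by exists X.
  rewrite -/U Us; apply: ideal_gen_min => //; apply: Pid.
  exact: (PX _ FX nX).1.
have nA : A <> set0.
  move=> AE; apply: (maxA A0); last by right; split.
  rewrite AE; split=> // /(_ 0) h; apply: h; apply: ideal0; exact: Pid.
case: PA => // -[PA sA]; exists A; split=> // B PB AB.
apply/seteqP; split=> //; apply: contrapT => nBA.
by apply: (maxA B) => //; right; split=> //; apply: subset_trans AB.
Qed.

Lemma noetherian_span (Y : set R) :
  exists s, [set` s] `<=` Y /\ Y `<=` ideal_gen s.
Proof.
pose P A := exists s, [set` s] `<=` Y /\ A = ideal_gen s.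
have [||A [[s [sY AE]] _ maxA]] := @noetherian_max P (ideal_gen [::]).
- by move=> _ [s [_ ->]]; apply: ideal_gen_is_ideal.
- by exists [::].
exists s; split=> // y Yy.
rewrite -AE -(maxA (ideal_gen (y :: s))).
- by apply: ideal_gen_mem; rewrite inE eqxx.
- exists (y :: s); split=> // z /=; rewrite inE => /orP[/eqP->//|]; exact: sY.
rewrite AE; apply: ideal_gen_min; first exact: ideal_gen_is_ideal.
by move=> z /= zs; apply: ideal_gen_mem; rewrite inE zs orbT.
Qed.

(** y spans a copy of R/P in R/J, for a maximal one, P, among the annihilators
    of nonzero elements: such a P is prime, and every zero divisor of R/J lies
    in one of these P. *)
Definition max_colon J y := ~ J y /\
  forall z, ~ J z -> (forall x, J (x * y) -> J (x * z)) ->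
    forall x, J (x * z) -> J (x * y).

Lemma max_colon_prime J y a b : is_ideal J -> max_colon J y ->
  J (a * b * y) -> J (a * y) \/ J (b * y).
Proof.
move=> iJ [nJy my] Jab; have [|nJby] := pselect (J (b * y)); first by right.
left; apply: (my (b * y)) => //; last by rewrite mulrA.
by move=> x Jxy; rewrite mulrCA; apply: idealM.
Qed.

Lemma zero_divisor_max_colon J x z : is_ideal J -> J (x * z) -> ~ J z ->
  exists y, max_colon J y /\ J (x * y).
Proof.
move=> iJ Jxz nJz.
pose P A := exists z, ~ J z /\ A = [set x | J (x * z)].
have [||A [[y [nJy AE]] sA maxA]] := @noetherian_max P [set x | J (x * z)].
- move=> _ [t [_ ->]]; split=> /=; first by rewrite mul0r; apply: ideal0.
  by move=> a u v /= Ju Jv; rewrite mulrDl -mulrA; apply: iJ.2.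
- by exists z.
exists y; split; last by move: (sA x Jxz); rewrite AE.
split=> // t nJt yt u Jut.
have : A u by rewrite -(maxA [set x | J (x * t)]) //; [exists t|rewrite AE].
by rewrite AE.
Qed.

Lemma max_colon_avoid J y s : is_ideal J -> max_colon J y ->
  (forall z, z \in s -> exists c, J (c * z) /\ ~ J (c * y)) ->
  exists c, (forall z, z \in s -> J (c * z)) /\ ~ J (c * y).
Proof.
move=> iJ my; elim: s => [|z s IH] sep.
  by exists 1; split=> //; rewrite mul1r; case: my.
have [|c [cs cy]] := IH.
  by move=> t ts; apply: sep; rewrite inE ts orbT.
have [|d [dz dy]] := sep z; first by rewrite inE eqxx.
exists (c * d); split; last by case/(max_colon_prime iJ my).
move=> t; rewrite inE => /orP[/eqP->|/cs ct]; first by rewrite -mulrA; apply: idealM.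
by rewrite mulrAC [_ * d]mulrC; apply: idealM.
Qed.

(** Finiteness of the set of maximal annihilators: if y is a combination of
    y_1, ..., y_r then ann y contains the intersection, hence by primality one,
    of the ann y_i. *)
Lemma max_colon_finite J : is_ideal J -> exists s,
  (forall y, y \in s -> max_colon J y) /\
  (forall y, max_colon J y ->
     exists2 z, z \in s & forall x, J (x * z) -> J (x * y)).
Proof.
move=> iJ; have [s [sY Ys]] := noetherian_span (max_colon J).
exists s; split=> [y /sY//|y my]; apply: contrapT => no.
have [|c [cs cy]] := max_colon_avoid (s := s) iJ my.
  move=> z zs; apply: contrapT => nc; apply: no; exists z => // x Jxz.
  by apply: contrapT => nJ; apply: nc; exists x.
apply: cy; have [d ->] := Ys y my; rewrite mulr_sumr; apply: ideal_sum => // i _.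
by rewrite mulrCA; apply: idealM => //; apply/cs/mem_nth.
Qed.

(** Prime avoidance for the coset f + A and the maximal annihilators, none of
    which contains J + (f) + A by the hypothesis. *)
Lemma coset_avoidance J A f : is_ideal J -> is_ideal A ->
  (forall y, J (f * y) -> (forall a, A a -> J (a * y)) -> J y) ->
  exists a, A a /\ nzd_mod J (f + a).
Proof.
move=> iJ iA faith; have [s [sm smax]] := max_colon_finite iJ.
have [a [Aa sa]] : exists a, A a /\ forall y, y \in s -> ~ J ((f + a) * y).
  elim: s sm {smax} => [|y s IH] sm; first by exists 0; split=> //; apply: ideal0.
  have [|a [Aa sa]] := IH; first by move=> z zs; apply: sm; rewrite inE zs orbT.
  have my : max_colon J y by apply: sm; rewrite inE eqxx.
  have [Jy|nJy] := pselect (J ((f + a) * y)); last first.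
    exists a; split=> // z; rewrite inE => /orP[/eqP->//|]; exact: sa.
  have [b [Ab nJb]] : exists b, A b /\ ~ J (b * y).
    apply: contrapT => no; have JA b : A b -> J (b * y).
      by move=> Ab; apply: contrapT => nJ; apply: no; exists b.
    case: my => nJy _; apply: nJy; apply: faith => //.
    rewrite (_ : f * y = (f + a) * y - a * y); last by ring.
    by apply: idealB => //; apply: JA.
  have [|c [cs cy]] := max_colon_avoid (s := s) iJ my.
    move=> z zs; apply: contrapT => nc.
    have zy x : J (x * z) -> J (x * y).
      by move=> Jz; apply: contrapT => nJ; apply: nc; exists x.
    have mz : max_colon J z by apply: sm; rewrite inE zs orbT.
    by apply: (sa z zs); apply: (mz.2 y) => //; case: my.
  (* The correction b c keeps f + a off the earlier primes, which contain c,
     and moves it off the new one, which contains neither b nor c. *)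
  exists (a + b * c); split; first by apply: idealD => //; rewrite mulrC; apply: idealM.
  have nbc : ~ J (b * c * y) by case/(max_colon_prime iJ my).
  move=> z; rewrite inE => /orP[/eqP-> J'|zs J'].
    apply: nbc.
    rewrite (_ : _ * y = (f + (a + b * c)) * y - (f + a) * y); last by ring.
    exact: idealB.
  apply: (sa z zs).
  rewrite (_ : (f + a) * z = (f + (a + b * c)) * z - b * (c * z)); last by ring.
  by apply: idealB => //; apply: idealM => //; apply: cs.
exists a; split=> // x Jx; apply: contrapT => nJx.
have [y [my Jy]] := zero_divisor_max_colon iJ Jx nJx.
have [z zs zy] := smax y my; apply: (sa z zs).
by apply: ((sm z zs).2 y) => //; case: my.
Qed.

End Noetherian.

(** * Regularity after localization at 1 + I *)

Section LocalRegularity.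
Variable R : comNzRingType.
Hypothesis noethR : noetherian_ring R.
Variable I : set R.
Hypothesis iI : is_ideal I.
Implicit Types (J K : set R) (a b u x y : R) (s : seq R).

(** The contraction to R of the extension of J to the localization of R at
    1 + I, a ring whose Jacobson radical contains I. *)
Definition locally J : set R := [set y | exists u, I (u - 1) /\ J (u * y)].

Lemma one_plusM u v : I (u - 1) -> I (v - 1) -> I (u * v - 1).
Proof.
move=> Iu Iv; rewrite (_ : _ - 1 = u * (v - 1) + (u - 1)); last by ring.
exact: iI.2.
Qed.

Lemma locally_sub J : J `<=` locally J.
Proof. by move=> x Jx; exists 1; rewrite subrr mul1r; split=> //; apply: iI.1. Qed.

Lemma locally_mono J K : J `<=` K -> locally J `<=` locally K.
Proof. by move=> JK x [u [Iu /JK]]; exists u. Qed.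

Lemma locally_ideal J : is_ideal J -> is_ideal (locally J).
Proof.
move=> iJ; split=> [|a x y [u [Iu Ju]] [v [Iv Jv]]].
  by apply: locally_sub; apply: ideal0.
exists (u * v); split; first exact: one_plusM.
rewrite (_ : _ * _ = (v * a) * (u * x) + u * (v * y)); last by ring.
by apply: iJ.2 => //; apply: idealM.
Qed.

Lemma locally_unit J u y : I (u - 1) -> locally J (u * y) -> locally J y.
Proof.
move=> Iu [v [Iv Jv]]; exists (v * u); split; first exact: one_plusM.
by rewrite -mulrA.
Qed.

(** The generators of the module K/J are eliminated one at a time: modulo the
    others, b equals a multiple of itself by an element of I. *)
Lemma nakayama_adjoins J a s : is_ideal J -> I a ->
  (forall y, adjoins J s y ->
     exists u k, [/\ I (u - 1), adjoins J s k & J (u * y - a * k)]) ->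
  adjoins J s `<=` locally J.
Proof.
move=> + Ia; elim: s J => [|b s IH] J iJ aK /=; first exact: locally_sub.
have iJb := adjoin_ideal b iJ.
have KJb : adjoins (adjoin J b) s `<=` locally (adjoin J b).
  apply: IH => // y /aK[u [k [Iu Kk Jk]]]; exists u, k; split=> //.
  exact: adjoin_sub.
have [u [k [Iu /KJb[v [Iv [c Jv]]] Jk]]] := aK b (adjoins_mem iJ (mem_head b s)).
have Jb : locally J b.
  exists (v * u - a * c); split.
    rewrite (_ : _ - 1 = - c * a + (v * u - 1)); last by ring.
    by apply: iI.2 => //; apply: one_plusM.
  rewrite (_ : _ * b = v * (u * b - a * k) + a * (v * k - c * b)); last by ring.
  by apply: iJ.2 => //; apply: idealM.
move=> y /KJb[w [Iw [e Jw]]]; apply: (locally_unit Iw).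
rewrite -(subrK (e * b) (w * y)); have iL := locally_ideal iJ.
by apply: idealD => //; [apply: locally_sub|apply: idealM].
Qed.

Lemma nakayama J K a : is_ideal J -> is_ideal K -> J `<=` K -> I a ->
  (forall y, K y -> exists u k, [/\ I (u - 1), K k & J (u * y - a * k)]) ->
  K `<=` locally J.
Proof.
move=> iJ iK JK Ia aK; have [s Ks] := noetherian_fg noethR iK.
suff KE : adjoins J s = K by move: aK; rewrite -KE; apply: nakayama_adjoins.
apply/seteqP; split.
  by apply: adjoins_min => // x; rewrite Ks; apply: ideal_gen_mem.
rewrite Ks; apply: ideal_gen_min; first exact: adjoins_ideal.
by move=> x /=; apply: adjoins_mem.
Qed.

Lemma nzd_locally J a : nzd_mod J a -> nzd_mod (locally J) a.
Proof. by move=> ra y [u [Iu]]; rewrite mulrCA => /ra; exists u. Qed.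

(** In a local ring the members of a regular sequence a, b can be exchanged;
    this is the half of the claim that needs Nakayama: the annihilator K of b
    modulo J satisfies K = aK. *)
Lemma nzd_locally_exchange J a b : is_ideal J -> I a ->
  nzd_mod (locally J) a -> nzd_mod (locally (adjoin J a)) b ->
  nzd_mod (locally J) b.
Proof.
move=> iJ Ia ra rb; have iL := locally_ideal iJ.
pose K : set R := [set y | locally J (b * y)].
have iK : is_ideal K.
  split=> [|c x y Kx Ky]; rewrite /K /=; first by rewrite mulr0; apply: iL.1.
  rewrite (_ : b * _ = c * (b * x) + b * y); last by ring.
  exact: iL.2.
(* An element y of K is a multiple a k modulo J, as b is regular modulo
   J + (a); then k is in K since a is regular modulo J. *)
suff KL : K `<=` locally (locally J).
  by move=> y /KL[u [Iu]]; apply: locally_unit.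
apply: (nakayama (a := a)) => // [y Jy|y Ky].
  by apply: idealM => //; apply: locally_sub.
have /rb[u [Iu [k Jk]]] : locally (adjoin J a) (b * y).
  by apply: locally_mono Ky; apply: adjoin_sub.
exists u, k; split=> //; last by rewrite (mulrC a); apply: locally_sub.
apply: ra; rewrite (_ : a * _ = u * (b * y) - b * (u * y - k * a)); last by ring.
apply: idealB => //; first exact: idealM.
by apply: idealM => //; apply: locally_sub.
Qed.

Lemma nzd_locally_adjoin J a b : is_ideal J ->
  nzd_mod (locally J) a -> nzd_mod (locally (adjoin J a)) b ->
  nzd_mod (locally (adjoin J b)) a.
Proof.
move=> iJ ra rb y [u [Iu [c Jc]]]; have iL := locally_ideal iJ.
have /rb[v [Iv [d Jd]]] : locally (adjoin J a) (b * c).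
  apply: locally_sub; exists (u * y).
  rewrite (_ : _ - _ = - (u * (a * y) - c * b)); last by ring.
  exact: idealN.
have /ra Jy : locally J (a * (v * u * y - b * d)).
  apply: locally_sub.
  rewrite (_ : a * _ = v * (u * (a * y) - c * b) + b * (v * c - d * a)); last by ring.
  by apply: iJ.2 => //; apply: idealM.
have iLb := locally_ideal (adjoin_ideal b iJ).
apply: (locally_unit (one_plusM Iv Iu)); rewrite -(subrK (b * d) (v * u * y)).
apply: idealD => //; first by apply: locally_mono Jy; apply: adjoin_sub.
by apply: locally_sub; rewrite mulrC; apply: adjoin_mem.
Qed.

Fixpoint locally_regular J s : Prop :=
  if s is a :: s' then nzd_mod (locally J) a /\ locally_regular (adjoin J a) s'
  else True.

Lemma adjoinC J a b : is_ideal J ->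
  adjoin (adjoin J a) b = adjoin (adjoin J b) a.
Proof.
have sub c d : is_ideal J -> adjoin (adjoin J c) d `<=` adjoin (adjoin J d) c.
  move=> iJ; have iJd := adjoin_ideal d iJ; have iJdc := adjoin_ideal c iJd.
  apply: adjoin_min => //; first apply: adjoin_min => //.
  - by apply: subset_trans (adjoin_sub _ _) => //; apply: adjoin_sub.
  - exact: adjoin_self.
  - by apply: adjoin_sub => //; apply: adjoin_self.
by move=> iJ; apply/seteqP; split; apply: sub.
Qed.

Lemma locally_regular_rcons J s a : is_ideal J -> I a -> [set` s] `<=` I ->
  nzd_mod (locally J) a -> locally_regular (adjoin J a) s ->
  locally_regular J (rcons s a).
Proof.
move=> + Ia; elim: s J => [//|b s IH] J iJ sI ra /= [rb rs]; split.
  exact: nzd_locally_exchange rb.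
apply: IH; first exact: adjoin_ideal.
- by move=> x xs; apply: sI; rewrite /= inE [_ \in _]xs orbT.
- exact: nzd_locally_adjoin.
- by rewrite adjoinC.
Qed.

Lemma locally_regular_congr J s a b : is_ideal J -> adjoins J s (a - b) ->
  locally_regular J (rcons s a) -> locally_regular J (rcons s b).
Proof.
elim: s J => [|c s IH] J iJ /= Jab [ra rs]; split=> //.
  move=> y Jby; apply: ra; rewrite -(subrK (b * y) (a * y)) -mulrBl.
  apply: idealD => //; first exact: locally_ideal.
  by apply: locally_sub; rewrite mulrC; apply: idealM.
by apply: IH => //; apply: adjoin_ideal.
Qed.

(** If I has n generators and depth at least n, then it is generated by a
    regular sequence, obtained by adding to each generator in turn a
    combination of the later ones (prime avoidance).  The original generators,
    in reverse order, are regular after localization, as each new generator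
    can be moved past the later ones and then be replaced by the old one. *)
Lemma regular_generators (p : nat) s (x : seq R) :
  (forall t, regular_mod [set 0] t -> [set` t] `<=` I -> (size t < p)%N ->
     forall y, (forall a, I a -> adjoins [set 0] t (a * y)) ->
     adjoins [set 0] t y) ->
  regular_mod [set 0] x -> I = adjoins [set 0] (x ++ s) ->
  (size (x ++ s) <= p)%N ->
  (exists z, regular_mod [set 0] (x ++ z) /\ I = adjoins [set 0] (x ++ z)) /\
  locally_regular (adjoins [set 0] x) (rev s).
Proof.
move=> depth; have i0 := is_ideal_zero R.
elim: s x => [|f s IH] x rx IE lep.
  by split=> //; exists [::]; rewrite cats0 in IE *.
set J := adjoins [set 0] x; have iJ : is_ideal J by apply: adjoins_ideal.
have mem_I c : c \in x ++ f :: s -> I c by rewrite {1}IE; apply: adjoins_mem.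
(* Here the depth of I enters: no nonzero element of R/J is killed by I. *)
have [a [sa ra]] : exists a, ideal_gen s a /\ nzd_mod J (f + a).
  apply: coset_avoidance => // [|y Jfy Jsy]; first exact: ideal_gen_is_ideal.
  apply: depth => //; first by move=> c cx; apply: mem_I; rewrite mem_cat [_ \in _]cx.
    by apply: leq_trans lep; rewrite size_cat /= addnS ltnS leq_addr.
  have iC : is_ideal [set b | J (b * y)].
    split=> [|b c d /= Jc Jd]; first by rewrite /= mul0r; apply: ideal0.
    by rewrite mulrDl -mulrA; apply: iJ.2.
  suff: I `<=` [set b | J (b * y)] by [].
  rewrite IE; apply: adjoins_min => // [_ ->|b].
    by rewrite /= mul0r; apply: ideal0.
  rewrite /= mem_cat inE => /or3P[bx|/eqP->//|bs]; last exact/Jsy/ideal_gen_mem.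
  by rewrite mulrC; apply: idealM => //; apply: adjoins_mem.
have JE : adjoins [set 0] (rcons x (f + a)) = adjoin J (f + a).
  by rewrite /adjoins -cats1 foldl_cat.
have sIa : I a.
  apply: (ideal_gen_min iI _ sa) => c cs.
  by apply: mem_I; rewrite mem_cat inE [_ \in s]cs !orbT.
have [|||[z [rz Iz]] ls] := IH (rcons x (f + a)).
- by rewrite -cats1; apply/regular_mod_cat; split.
- have Ifa : I (f + a).
    by apply: idealD => //; apply: mem_I; rewrite mem_cat inE eqxx orbT.
  apply/seteqP; split; last first.
    apply: adjoins_min => // [_ ->|c]; first exact: ideal0.
    rewrite /= mem_cat mem_rcons inE => /orP[/orP[/eqP->//|cx]|cs].
      by apply: mem_I; rewrite mem_cat cx.
    by apply: mem_I; rewrite mem_cat inE cs !orbT.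
  rewrite {1}IE; have iK := adjoins_ideal (rcons x (f + a) ++ s) i0.
  apply: adjoins_min => // [_ ->|c]; first exact: ideal0.
  rewrite /= mem_cat inE => /or3P[cx|/eqP->|cs].
  + by apply: adjoins_mem => //; rewrite mem_cat mem_rcons inE cx orbT.
  + rewrite -[X in _ X](addrK a f); apply: idealB => //.
      by apply: adjoins_mem => //; rewrite mem_cat mem_rcons inE eqxx.
    apply: (ideal_gen_min iK _ sa) => d ds.
    by apply: adjoins_mem => //; rewrite mem_cat [_ \in s]ds orbT.
  + by apply: adjoins_mem => //; rewrite mem_cat cs orbT.
- by move: lep; rewrite !size_cat size_rcons /= addnS.
split.
  by exists (f + a :: z); rewrite -cat_rcons.
(* In the reversed sequence f + a becomes the last term, after s; as a is in
   (s), it may be replaced by f. *)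
rewrite rev_cons; apply: (@locally_regular_congr _ _ (f + a)) => //.
  rewrite addrAC subrr add0r.
  apply: (ideal_gen_min _ _ sa); first exact: adjoins_ideal.
  by move=> c cs; apply: adjoins_mem => //; rewrite mem_rev.
apply: locally_regular_rcons => //.
- by apply: idealD => //; apply: mem_I; rewrite mem_cat inE eqxx orbT.
- by move=> c; rewrite /= mem_rev => cs; apply: mem_I; rewrite mem_cat inE cs !orbT.
- exact: nzd_locally.
- by rewrite -JE.
Qed.

End LocalRegularity.

(** * Free modules *)

Lemma big_sub_uniq (V : zmodType) (T : eqType) (s t : seq T) (f : T -> V) :
  uniq s -> uniq t -> {subset s <= t} -> (forall x, x \notin s -> f x = 0) ->
  \sum_(x <- t) f x = \sum_(x <- s) f x.
Proof.
move=> us ut st f0; rewrite (bigID (mem s)) /= [X in _ + X]big1 // addr0.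
rewrite -big_filter; apply: perm_big; apply: uniq_perm => //.
  exact: filter_uniq.
by move=> x; rewrite mem_filter andb_idr //; apply: st.
Qed.

Section Submodules.
Variable R : comNzRingType.
Implicit Types (J K : set R) (V W : lmodType R).

Lemma smul_set0 J V : smul_set J (0 : V).
Proof. by exists [::]; split=> //; rewrite big_nil. Qed.

Lemma smul_setD J V (v w : V) :
  smul_set J v -> smul_set J w -> smul_set J (v + w).
Proof.
move=> [s [sJ ->]] [t [tJ ->]]; exists (s ++ t); rewrite big_cat; split=> // p.
by rewrite mem_cat => /orP[/sJ|/tJ].
Qed.

Lemma smul_setZ J V a (v : V) : smul_set J v -> smul_set J (a *: v).
Proof.
move=> [s [sJ ->]]; exists [seq (p.1, a *: p.2) | p <- s]; split.
  by move=> _ /mapP[p /sJ ? ->].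
rewrite big_map scaler_sumr; apply: eq_bigr => p _ /=.
by rewrite !scalerA mulrC.
Qed.

Lemma smul_setN J V (v : V) : smul_set J v -> smul_set J (- v).
Proof. by rewrite -scaleN1r; apply: smul_setZ. Qed.

Lemma smul_set_sum J V (T : eqType) (r : seq T) (f : T -> V) :
  (forall i, i \in r -> smul_set J (f i)) -> smul_set J (\sum_(i <- r) f i).
Proof.
move=> Jf; rewrite big_seq; elim/big_rec: _ => [|i x ir Jx].
  exact: smul_set0.
by apply: smul_setD => //; apply: Jf.
Qed.

Lemma smul_set_scale J V a (v : V) : J a -> smul_set J (a *: v).
Proof.
move=> Ja; exists [:: (a, v)]; rewrite big_seq1; split=> // p.
by rewrite inE => /eqP->.
Qed.

Lemma smul_set_sub J K V (v : V) : J `<=` K -> smul_set J v -> smul_set K v.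
Proof. by move=> JK [s [sJ ->]]; exists s; split=> // p /sJ/JK. Qed.

Lemma smul_set_linear J V W (h : {linear V -> W}) v :
  smul_set J v -> smul_set J (h v).
Proof.
move=> [s [sJ ->]]; rewrite linear_sum; apply: smul_set_sum => p ps.
by rewrite linearZ; apply/smul_set_scale/sJ.
Qed.

Lemma smul_set_zero V (v : V) : smul_set [set 0] v -> v = 0.
Proof.
move=> [s [s0 ->]]; rewrite big_seq big1 // => p ps.
by rewrite (s0 p ps) scale0r.
Qed.

Lemma smul_set_adjoin J V a (v : V) :
  smul_set (adjoin J a) v -> exists y, smul_set J (v - a *: y).
Proof.
move=> [s [sJ ->]]; elim: s sJ => [|p s IH] sJ.
  by exists 0; rewrite big_nil scaler0 subr0; apply: smul_set0.
have [|y Jy] := IH; first by move=> q qs; apply: sJ; rewrite inE qs orbT.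
have [|c Jc] := sJ p; first by rewrite inE eqxx.
exists (c *: p.2 + y); rewrite big_cons scalerDr opprD addrACA.
apply: smul_setD => //; rewrite scalerA mulrC -scalerBl.
exact: smul_set_scale.
Qed.

End Submodules.

Section Bases.
Variables (R : comNzRingType) (V : lmodType R) (B : set V).
Hypothesis basisB : is_basis B.

Lemma basis_rep v : exists sc : seq V * (V -> R),
  [/\ uniq sc.1, [set` sc.1] `<=` B, v = \sum_(b <- sc.1) sc.2 b *: b
    & forall b, b \notin sc.1 -> sc.2 b = 0].
Proof.
have [[s [c [sB ->]]] _] := (basisB.1 v, tt).
elim: s sB => [|x s IH] sB; first by exists ([::], fun=> 0); rewrite !big_nil; split.
have [|[t d] /= [ut tB sE d0]] := IH.
  by move=> z zs; apply: sB; rewrite /= inE [_ \in _]zs orbT.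
have Bx : B x by apply: sB; rewrite /= inE eqxx.
pose d' z := d z + (z == x)%:R * c x.
have tE u : uniq u -> x \in u -> {subset t <= u} ->
    c x *: x + \sum_(b <- t) d b *: b = \sum_(b <- u) d' b *: b.
  move=> uu xu tu; under [RHS]eq_bigr do rewrite scalerDl.
  rewrite big_split /= addrC; congr (_ + _).
    rewrite (big_sub_uniq (s := [:: x])) // ?big_seq1 ?eqxx ?mul1r //.
      by move=> z; rewrite inE => /eqP->.
    by move=> z; rewrite inE => /negPf->; rewrite mul0r scale0r.
  by rewrite (big_sub_uniq ut uu tu) // => b /d0->; rewrite scale0r.
rewrite big_cons sE; have [xt|xt] := boolP (x \in t).
  exists (t, d'); split=> //=; first exact: tE.
  move=> b bt; rewrite /d' d0 // add0r; case: eqP => [bx|_]; last by rewrite mul0r.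
  by rewrite bx xt in bt.
exists (x :: t, d'); split=> /=; first by rewrite xt.
- by move=> z /=; rewrite inE => /orP[/eqP->|/tB].
- by apply: tE => /=; rewrite ?xt ?inE ?eqxx // => z zt; rewrite inE zt orbT.
- by move=> b; rewrite inE negb_or => /andP[/negPf bx /d0]; rewrite /d' bx mul0r addr0.
Qed.

Lemma basis_uniq s (c : V -> R) t d : uniq s -> uniq t ->
  [set` s] `<=` B -> [set` t] `<=` B ->
  (forall b, b \notin s -> c b = 0) -> (forall b, b \notin t -> d b = 0) ->
  \sum_(b <- s) c b *: b = \sum_(b <- t) d b *: b -> c = d.
Proof.
move=> us ut sB tB c0 d0 eq_sum; pose u := undup (s ++ t).
have uu : uniq u by apply: undup_uniq.
have su : {subset s <= u} by move=> z zs; rewrite mem_undup mem_cat zs.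
have tu : {subset t <= u} by move=> z zt; rewrite mem_undup mem_cat zt orbT.
apply/funext => b; apply/eqP; rewrite -subr_eq0; apply/eqP.
have [bu|] := boolP (b \in u); last first.
  by rewrite mem_undup mem_cat negb_or => /andP[/c0-> /d0->]; rewrite subrr.
apply: (basisB.2 u (fun b => c b - d b)) => //.
  by move=> z; rewrite /= mem_undup mem_cat => /orP[/sB|/tB].
under eq_bigr do rewrite scalerBl.
rewrite sumrB (big_sub_uniq us uu su); last by move=> z /c0->; rewrite scale0r.
rewrite (big_sub_uniq ut uu tu) ?eq_sum ?subrr // => z /d0->.
by rewrite scale0r.
Qed.

Lemma basis_coord_exists : exists co : V -> {linear V -> R^o},
  (forall v, exists s, [/\ uniq s, [set` s] `<=` B,
     v = \sum_(b <- s) (co b v : R) *: b & forall b, b \notin s -> co b v = 0])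
  /\ forall b b', B b' -> co b b' = (b == b')%:R.
Proof.
have [rep repP] := choice basis_rep.
have lin b : linear ((fun v => (rep v).2 b) : V -> R^o).
  move=> a x y; have [ux xB xE x0] := repP x; have [uy yB yE y0] := repP y.
  have [ul lB lE l0] := repP (a *: x + y).
  pose d b := a * (rep x).2 b + (rep y).2 b.
  pose u := undup ((rep x).1 ++ (rep y).1).
  have uu : uniq u by apply: undup_uniq.
  have xu : {subset (rep x).1 <= u} by move=> z zs; rewrite mem_undup mem_cat zs.
  have yu : {subset (rep y).1 <= u}.
    by move=> z zt; rewrite mem_undup mem_cat zt orbT.
  suff -> : (rep (a *: x + y)).2 = d by [].
  apply: (basis_uniq ul uu lB) => //.
  - by move=> z; rewrite /= mem_undup mem_cat => /orP[/xB|/yB].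
  - move=> z; rewrite mem_undup mem_cat negb_or /d => /andP[/x0-> /y0->].
    by rewrite mulr0 addr0.
  rewrite -lE {1}xE {1}yE; under [RHS]eq_bigr do rewrite scalerDl -scalerA.
  rewrite big_split /= -scaler_sumr; congr (_ *: _ + _).
    by rewrite (big_sub_uniq ux uu xu) // => z /x0->; rewrite scale0r.
  by rewrite (big_sub_uniq uy uu yu) // => z /y0->; rewrite scale0r.
pose co b : {linear V -> R^o} :=
  HB.pack (fun v => (rep v).2 b : R^o) (GRing.isLinear.Build R V R^o *:%R _ (lin b)).
exists co; split=> [v|b b' Bb']; first by exists (rep v).1; have [? ? ? ?] := repP v.
have [ub bB bE b0] := repP b'.
suff -> : co b b' = (fun b => (b == b')%:R) b :> R by [].
suff : (rep b').2 = (fun b => (b == b')%:R) by move/(congr1 (@^~ b)).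
apply: (basis_uniq (t := [:: b']) ub) => //.
- by move=> z /=; rewrite inE => /eqP->.
- by move=> z; rewrite inE => /negPf->.
- by rewrite -bE big_seq1 eqxx scale1r.
Qed.

Definition basis_coord : V -> {linear V -> R^o} :=
  sval (cid basis_coord_exists).

Lemma basis_expand v : exists s, [/\ uniq s, [set` s] `<=` B,
  v = \sum_(b <- s) (basis_coord b v : R) *: b
  & forall b, b \notin s -> basis_coord b v = 0].
Proof. by rewrite /basis_coord; case: cid => co [] /=. Qed.

Lemma basis_coord_delta b b' : B b' -> basis_coord b b' = (b == b')%:R.
Proof. by rewrite /basis_coord; case: cid => co [] /= _; apply. Qed.

Lemma basis_coordD b v w :
  basis_coord b (v + w) = basis_coord b v + basis_coord b w :> R.
Proof. exact: linearD. Qed.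

Lemma basis_coordB b v w :
  basis_coord b (v - w) = basis_coord b v - basis_coord b w :> R.
Proof. exact: linearB. Qed.

Lemma basis_coordZ b a v : basis_coord b (a *: v) = a * basis_coord b v :> R.
Proof. exact: linearZ_LR. Qed.

Lemma basis_coord_sum b (T : eqType) (r : seq T) (f : T -> V) :
  basis_coord b (\sum_(i <- r) f i) = \sum_(i <- r) basis_coord b (f i) :> R.
Proof. exact: linear_sum. Qed.

Lemma smul_set_coord J (v : V) : is_ideal J ->
  smul_set J v <-> forall b, B b -> J (basis_coord b v).
Proof.
move=> iJ; split=> [[s [sJ ->]] b Bb|Jv].
  rewrite basis_coord_sum; apply: ideal_sum => // p /sJ Jp.
  by rewrite basis_coordZ mulrC; apply: idealM.
have [s [_ sB -> _]] := basis_expand v; apply: smul_set_sum => b bs.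
by apply/smul_set_scale/Jv/sB.
Qed.

Lemma smul_set_nzd J a (v : V) : is_ideal J -> nzd_mod J a ->
  smul_set J (a *: v) -> smul_set J v.
Proof.
move=> iJ ra /(smul_set_coord _ iJ) Jav; apply/smul_set_coord => // b Bb.
by apply: ra; rewrite -basis_coordZ; apply: Jav.
Qed.

Lemma linear_basis_ext (W : lmodType R) (h h' : {linear V -> W}) :
  (forall b, B b -> h b = h' b) -> forall v, h v = h' v.
Proof.
move=> hh' v; have [s [_ sB -> _]] := basis_expand v; rewrite !linear_sum.
by apply: eq_big_seq => b /sB/hh' hb; rewrite !linearZ hb.
Qed.

Lemma basis_extend (W : lmodType R) (phi : V -> W) :
  exists h : {linear V -> W}, forall b, B b -> h b = phi b.
Proof.
have [supp suppP] := choice basis_expand.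
pose h v := \sum_(b <- supp v) (basis_coord b v : R) *: phi b.
have hE v u : uniq u -> {subset supp v <= u} ->
    h v = \sum_(b <- u) (basis_coord b v : R) *: phi b.
  have [us _ _ c0] := suppP v; move=> uu su; rewrite (big_sub_uniq us uu su) //.
  by move=> b /c0->; rewrite scale0r.
have lin : linear h.
  move=> a x y; pose u := undup (supp x ++ supp y ++ supp (a *: x + y)).
  have uu : uniq u by apply: undup_uniq.
  rewrite !(hE _ u) //; try by move=> z zs; rewrite mem_undup !mem_cat zs ?orbT.
  rewrite scaler_sumr -big_split /=; apply: eq_bigr => b _.
  by rewrite basis_coordD basis_coordZ scalerDl scalerA.
pose H : {linear V -> W} := HB.pack h (GRing.isLinear.Build R V W *:%R h lin).
exists H => b Bb; have [us sB bE c0] := suppP b.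
rewrite [LHS](hE b (undup (b :: supp b))) ?undup_uniq //; last first.
  by move=> z zs; rewrite mem_undup inE zs orbT.
rewrite (big_sub_uniq (s := [:: b])) ?undup_uniq // ?big_seq1.
- by rewrite basis_coord_delta // eqxx scale1r.
- by move=> z; rewrite inE => /eqP->; rewrite mem_undup inE eqxx.
- by move=> z; rewrite inE => /negPf zb; rewrite basis_coord_delta // zb scale0r.
Qed.

(** Lifting of maps from a free module, in the form needed to build maps of
    complexes: p need only hit the values of h. *)
Lemma basis_lift (A C : lmodType R) (p : {linear A -> C}) (h : {linear V -> C}) :
  (forall v, exists y, p y = h v) ->
  exists h' : {linear V -> A}, forall v, p (h' v) = h v.
Proof.
move=> /choice[phi phiP]; have [h' h'E] := basis_extend phi.
exists h'; apply: (@linear_basis_ext C (p \o h')) => b Bb /=.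
by rewrite h'E.
Qed.

Lemma finite_basis : fin_gen V -> exists t, uniq t /\ [set` t] = B.
Proof.
move=> [s sP]; have [supp suppP] := choice basis_expand.
pose t := undup (flatten [seq supp v | v <- s]).
exists t; split; first exact: undup_uniq.
apply/seteqP; split=> [b|b Bb] /=.
  by rewrite mem_undup => /flatten_mapP[v _ bv]; have [_ vB _ _] := suppP v; apply: vB.
apply/negPn/negP => nbt; have := oner_neq0 R; case/eqP.
have <- : basis_coord b b = 1 :> R by rewrite basis_coord_delta // eqxx.
have [c {2}->] := sP b; rewrite basis_coord_sum big_seq big1 // => v vs.
rewrite basis_coordZ; have [_ _ _ ->] := suppP v; first by rewrite mulr0.
apply: contra nbt => bv; rewrite mem_undup; apply/flatten_mapP.
by exists v.
Qed.

Lemma basis_nonempty (v : V) : v <> 0 -> exists b, B b.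
Proof.
move=> nv; have [[|b s] [_ sB vE _]] := basis_expand v.
  by case: nv; rewrite vE big_nil.
by exists b; apply: sB; rewrite /= inE eqxx.
Qed.

End Bases.

Lemma free_projective (R : comNzRingType) (P : lmodType R) :
  free_module P -> projective_module P.
Proof.
move=> [B basisB] A C p h surj; apply: (basis_lift basisB) => v.
exact: surj.
Qed.

(** * Free resolutions modulo a regular sequence *)

Section Exactness.
Variables (R : comNzRingType) (M : lmodType R) (F : resolution M).
Hypothesis freeF : free_resolution F.

Lemma res_diffK n (x : F n.+2) : res_diff F n (res_diff F n.+1 x) = 0.
Proof. by apply/res_exact; exists x. Qed.

(** Vanishing of the homology of F/JF in degrees greater than N. *)
Definition exact_mod J N := forall n, (N <= n)%N -> forall x : F n.+1,
  smul_set J (res_diff F n x) -> exists w, smul_set J (x - res_diff F n.+1 w).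

Lemma exact_mod_zero : exact_mod [set 0] 0.
Proof.
move=> n _ x /smul_set_zero/res_exact[w wE]; exists w.
by rewrite wE subrr; apply: smul_set0.
Qed.

(** If d x = a y modulo J, then a d y = 0, hence d y = 0, modulo J, so y is a
    boundary d z and x - a z a cycle modulo J.  The vanishing of d d uses up
    one degree. *)
Lemma exact_mod_adjoin J a N : is_ideal J -> nzd_mod J a -> exact_mod J N ->
  exact_mod (adjoin J a) N.+1.
Proof.
move=> iJ ra exJ [//|n] Nn x /smul_set_adjoin[y Jy].
have [B basisB] := freeF n.
have [|z Jz] := exJ n Nn y.
  apply: (smul_set_nzd basisB iJ ra); rewrite -linearZ -[_ *: y]opprK linearN.
  apply: smul_setN; rewrite -[X in smul_set _ X]add0r -{1}(res_diffK x) -linearD.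
  exact: smul_set_linear.
have [|w Jw] := exJ n.+1 (leqW Nn) (x - a *: z).
  rewrite linearB linearZ /= -(subrK (a *: y) (res_diff _ _ x)) -addrA -scalerBr.
  by apply: smul_setD => //; apply: smul_setZ.
exists w; have -> : x - res_diff F n.+2 w = (x - a *: z - res_diff F n.+2 w) + a *: z.
  by rewrite addrAC subrK.
apply: smul_setD; last exact/smul_set_scale/adjoin_self.
by apply: smul_set_sub Jw; apply: adjoin_sub.
Qed.

(** For J generated by a regular sequence s, R/J has a Koszul resolution of
    length size s, so Tor_i(M, R/J) = 0 for i > size s. *)
Lemma exact_mod_regular s : regular_mod [set 0] s ->
  exact_mod (adjoins [set 0] s) (size s).
Proof.
have gen J N t : is_ideal J -> regular_mod J t -> exact_mod J N ->
    exact_mod (adjoins J t) (N + size t).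
  elim: t J N => [|a t IH] J N iJ /=; first by rewrite addn0.
  move=> [ra rt] exJ; rewrite addnS -addSn; apply: IH => //.
    exact: adjoin_ideal.
  exact: exact_mod_adjoin.
by move=> rs; apply: (gen _ 0%N) => //; [apply: is_ideal_zero|apply: exact_mod_zero].
Qed.

(** As the differential of F/(g)F is zero, F/(g)F coincides with its homology
    Tor(M, R/(g)), which vanishes in large degrees; a free module F_i with
    F_i = (g)F_i is zero. *)
Lemma g_weak_vanishing g : regular_sequence g ->
  diff_lands_in (ideal_gen g) F ->
  forall i, (size g < i)%N -> forall x : F i, x = 0.
Proof.
move=> /regular_sequenceE[rg g1]; rewrite ideal_genE in g1 * => dF [//|n] ng x.
have iJ := adjoins_ideal g (is_ideal_zero R).
have Jx (y : F n.+1) : smul_set (adjoins [set 0] g) y.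
  have [w Jw] := exact_mod_regular rg ng (dF n y).
  by rewrite -(subrK (res_diff F n.+1 w) y); apply: smul_setD.
have [B basisB] := freeF n.+1.
apply: contrapT => /(basis_nonempty basisB)[b Bb]; apply: g1.
have := Jx b; move/(smul_set_coord basisB _ iJ)/(_ b Bb).
by rewrite basis_coord_delta // eqxx.
Qed.

(** The depth of the ideal I on R is at least p: the last differential
    F_p -> F_(p-1), whose entries lie in I, stays injective modulo a regular
    sequence of length less than p, so only 0 is killed by I. *)
Lemma depth_resolution (I : set R) p (w : F p) t y :
  is_ideal I -> diff_lands_in I F -> w <> 0 -> (forall x : F p.+1, x = 0) ->
  regular_mod [set 0] t -> (size t < p)%N ->
  (forall a, I a -> adjoins [set 0] t (a * y)) -> adjoins [set 0] t y.
Proof.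
case: p w => [//|p] w iI dF nw F0 rt tp yI.
have iJ := adjoins_ideal t (is_ideal_zero R).
have [B basisB] := freeF p.+1; have [b Bb] := basis_nonempty basisB nw.
have [|x Jx] := exact_mod_regular rt tp (x := y *: b).
  rewrite linearZ /=; have [s [sI ->]] := dF p b; rewrite scaler_sumr.
  apply: smul_set_sum => q qs; rewrite scalerA; apply: smul_set_scale.
  by rewrite mulrC; apply/yI/sI.
move: Jx; rewrite (F0 x) linear0 subr0.
move/(smul_set_coord basisB _ iJ)/(_ b Bb).
by rewrite basis_coordZ basis_coord_delta // eqxx mulr1.
Qed.

End Exactness.

(** * Null-homotopies *)

Section Homotopy.
Variables (R : comNzRingType) (M : lmodType R) (F : resolution M).
Hypothesis freeF : free_resolution F.
Variable a : R.
Hypothesis aM : forall y : M, a *: y = 0.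

Lemma homotopy0 : exists h : {linear F 0%N -> F 1%N},
  forall x, res_diff F 0%N (h x) = a *: x.
Proof.
have [B basisB] := freeF 0%N.
apply: (@basis_lift _ _ _ basisB _ _ _ (a \*: idfun)) => x /=.
by apply/res_exact0; rewrite linearZ /= aM.
Qed.

Lemma homotopyS i (h : {linear F i -> F i.+1}) :
  (forall x, res_diff F i (h (res_diff F i x)) = a *: res_diff F i x) ->
  exists h' : {linear F i.+1 -> F i.+2},
    forall x, res_diff F i.+1 (h' x) = a *: x - h (res_diff F i x).
Proof.
move=> hP; have [B basisB] := freeF i.+1.
apply: (@basis_lift _ _ _ basisB _ _ _ ((a \*: idfun) \- (h \o res_diff F i))) => x /=.
by apply/res_exact; rewrite linearB linearZ /= hP subrr.
Qed.

(** Multiplication by a is zero on M, hence null-homotopic on F; only two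
    consecutive components of the homotopy are used at a time. *)
Lemma homotopy i : exists (h : {linear F i -> F i.+1})
    (h' : {linear F i.+1 -> F i.+2}),
  forall x, res_diff F i.+1 (h' x) = a *: x - h (res_diff F i x).
Proof.
suff [h /[dup] hP /homotopyS[h' ?]] : exists h : {linear F i -> F i.+1},
    forall x, res_diff F i (h (res_diff F i x)) = a *: res_diff F i x.
  by exists h, h'.
elim: i => [|i [h /homotopyS[h' h'P]]].
  by have [h hP] := homotopy0; exists h => x; rewrite hP.
by exists h' => x; rewrite h'P res_diffK linear0 subr0.
Qed.

End Homotopy.


(** * Resolutions of R/I with entries in I *)

Section QuotientResolution.
Variables (R : comNzRingType) (I : idealr R).
Variable F : resolution {ideal_quot I}.
Hypothesis freeF : free_resolution F.

Lemma pi_eq0 x : (\pi_{ideal_quot I} x == 0) = (x \in I).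
Proof.
by rewrite -[in RHS](subr0 x) Quotient.idealrBE -(rmorph0 (\pi_{ideal_quot I})).
Qed.

Lemma quot_scaleE (a : R) (y : {ideal_quot I}) : a *: y = \pi a * y.
Proof. by []. Qed.

Lemma quot_annihilated a (y : {ideal_quot I}) : [set` I] a -> a *: y = 0.
Proof.
move=> Ia; have /eqP aI : \pi_{ideal_quot I} a == 0 by rewrite pi_eq0.
by rewrite quot_scaleE aI mul0r.
Qed.

Lemma res_aug_ker J x : diff_lands_in J F -> res_aug F x = 0 -> smul_set J x.
Proof. by move=> dF /res_exact0[y <-]; apply: dF. Qed.

Lemma res0_nonempty (B : set (F 0%N)) : is_basis B -> exists b, B b.
Proof.
move=> basisB; have [x x1] := res_aug_surj F 1.
apply: (basis_nonempty basisB (v := x)) => x0; move/eqP: x1.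
by rewrite x0 linear0 eq_sym (negPf (oner_neq0 _)).
Qed.

(** The submodule I F_0 is in the kernel of F_0 -> R/I, which is the image of
    F_1, hence in J F_0; read off one coordinate. *)
Lemma diff_lands_in_sub J : is_ideal J -> diff_lands_in J F -> [set` I] `<=` J.
Proof.
move=> iJ dF a Ia; have [B basisB] := freeF 0%N.
have [b Bb] := res0_nonempty basisB.
have /(smul_set_coord basisB _ iJ)/(_ b Bb) : smul_set J (a *: b).
  by apply: res_aug_ker => //; rewrite linearZ /= quot_annihilated.
by rewrite basis_coordZ basis_coord_delta // eqxx mulr1.
Qed.

Hypothesis dF : diff_lands_in [set` I] F.

Let iI := is_ideal_idealr I.

Let nI1 : ~ [set` I] 1. Proof. by rewrite /= idealr1. Qed.

(** F_0/IF_0 is isomorphic to R/I.  Concretely, if basis elements b, b' map to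
    the classes of x, x', then x' b - x b' is in the kernel, hence in IF_0. *)
Lemma rank_res0 (B : set (F 0%N)) : is_basis B -> exists e, B = [set e].
Proof.
move=> basisB; have [e Be] := res0_nonempty basisB.
exists e; apply/seteqP; split=> [b Bb|_ ->//]; apply: contrapT => nbe.
have nbe' : (b == e) = false by apply/eqP.
pose x := repr (res_aug F b); pose y := repr (res_aug F e).
have Iz : smul_set [set` I] (y *: b - x *: e).
  apply: res_aug_ker => //; rewrite linearB !linearZ /= !quot_scaleE.
  by rewrite !reprK mulrN mulrC subrr.
have [] : smul_set [set` I] b.
  apply: res_aug_ker => //; rewrite -[LHS]reprK; apply/eqP; rewrite pi_eq0 -/x.
  rewrite -[x]opprK; apply: (idealN iI).
  have := (smul_set_coord basisB _ iI).1 Iz e Be.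
  rewrite basis_coordB !basis_coordZ !basis_coord_delta // eqxx eq_sym nbe'.
  by rewrite mulr0 mulr1 sub0r.
move=> s Ib; apply: nI1.
have /(smul_set_coord basisB _ iI)/(_ b Bb) : smul_set [set` I] b by exists s.
by rewrite basis_coord_delta // eqxx.
Qed.

Variables (e : F 0%N) (basis0 : is_basis [set e]).
Variables (t : seq (F 1%N)) (ut : uniq t) (basis1 : is_basis [set` t]).

(** The first differential, as a map F_1 -> R, under the identification of
    F_0 = Re with R. *)
Definition diff1 y : R := basis_coord basis0 e (res_diff F 0 y).

Lemma res0_expand x : x = (basis_coord basis0 e x : R) *: e.
Proof.
have [s [us se xE c0]] := basis_expand basis0 x.
rewrite {1}xE.
transitivity (\sum_(b <- [:: e]) (basis_coord basis0 b x : R) *: b); last first.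
  by rewrite big_seq1.
apply/esym; apply: big_sub_uniq => // [z /se ->|b /c0->]; first by rewrite inE.
by rewrite scale0r.
Qed.

Lemma res_diff1E y : res_diff F 0 y = diff1 y *: e.
Proof. exact: res0_expand. Qed.

Lemma res1_expand y : y = \sum_(b <- t) (basis_coord basis1 b y : R) *: b.
Proof.
have [s [us se yE c0]] := basis_expand basis1 y.
by rewrite {1}yE; apply/esym/big_sub_uniq => // b /c0->; rewrite scale0r.
Qed.

Lemma diff1_sum (c : F 1%N -> R) :
  diff1 (\sum_(b <- t) c b *: b) = \sum_(b <- t) c b * diff1 b.
Proof.
rewrite /diff1 linear_sum basis_coord_sum; apply: eq_bigr => b _.
by rewrite linearZ basis_coordZ.
Qed.

Lemma diff1_expand y :
  diff1 y = \sum_(b <- t) (basis_coord basis1 b y : R) * diff1 b.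
Proof. by rewrite {1}(res1_expand y) diff1_sum. Qed.

Lemma mem_diff1 y : [set` I] (diff1 y).
Proof. by apply: (smul_set_coord basis0 _ iI).1 => //; apply: dF. Qed.

Lemma diff1_surj a : [set` I] a -> exists y, diff1 y = a.
Proof.
move=> Ia; have : res_aug F (a *: e) = 0 by rewrite linearZ /= quot_annihilated.
move=> /res_exact0[y yE]; exists y.
by rewrite /diff1 yE basis_coordZ basis_coord_delta // eqxx mulr1.
Qed.

Lemma ideal_diff1 : [set` I] = ideal_gen (map diff1 t).
Proof.
apply/seteqP; split=> [_ /diff1_surj[y <-]|]; last first.
  apply: ideal_gen_min => // _ /= /mapP[b _ ->]; exact: mem_diff1.
have iG := ideal_gen_is_ideal (map diff1 t).
rewrite diff1_expand; apply: ideal_sum => // b bt; apply: idealM => //.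
by apply: ideal_gen_mem; apply: map_f.
Qed.

(** The syzygies of the generators come from F_2, so their coefficients are
    in I; this amounts to the freeness of I/I^2 over R/I. *)
Lemma diff1_syzygy (c : F 1%N -> R) :
  \sum_(b <- t) c b * diff1 b = 0 -> forall b, b \in t -> [set` I] (c b).
Proof.
rewrite -diff1_sum => c0 b bt.
have : res_diff F 0 (\sum_(b <- t) c b *: b) = 0 by rewrite res_diff1E c0 scale0r.
move=> /res_exact[z zE]; have := dF z; rewrite zE.
move/(smul_set_coord basis1 _ iI)/(_ b bt).
rewrite basis_coord_sum (big_rem b) //= big_seq big1 ?addr0 => [|b' b't].
  by rewrite basis_coordZ basis_coord_delta // eqxx mulr1.
have [b'b b't'] : b' != b /\ b' \in t by move: b't; rewrite mem_rem_uniq // inE => /andP[].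
by rewrite basis_coordZ basis_coord_delta // eq_sym (negPf b'b) mulr0.
Qed.

(** As dF lies in IF, for w in IF the boundary d w is a combination of the
    generators diff1 b with coefficients z b in IF; the differences y b - z b
    are then syzygies of the generators, coordinate by coordinate. *)
Lemma boundary_coefficients i (w : F i.+1) (y : F 1%N -> F i) :
  smul_set [set` I] w -> res_diff F i w = \sum_(b <- t) diff1 b *: y b ->
  forall b, b \in t -> smul_set [set` I] (y b).
Proof.
move=> [s [sI ->]] dE.
have [z [zI zE]] : exists z : F 1%N -> F i, (forall b, smul_set [set` I] (z b)) /\
    res_diff F i (\sum_(p <- s) p.1 *: p.2) = \sum_(b <- t) diff1 b *: z b.
  elim: s sI {dE} => [|p s IH] sI.
    exists (fun=> 0); split=> [b|]; first exact: smul_set0.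
    by rewrite big_nil linear0 big1 // => b _; rewrite scaler0.
  have [|z [zI zE]] := IH; first by move=> q qs; apply: sI; rewrite inE qs orbT.
  have [|u uE] := diff1_surj (a := p.1); first by apply: sI; rewrite inE eqxx.
  exists (fun b => (basis_coord basis1 b u : R) *: res_diff F i p.2 + z b).
  split=> [b|]; first by apply: smul_setD => //; apply/smul_setZ/dF.
  rewrite big_cons linearD zE linearZ /= -uE diff1_expand scaler_suml.
  by rewrite -big_split /=; apply: eq_bigr => b _; rewrite scalerDr scalerA mulrC.
move=> b bt; have [B basisB] := freeF i.
rewrite -(subrK (z b) (y b)); apply: smul_setD => //.
apply/(smul_set_coord basisB _ iI) => b' Bb'.
apply: (@diff1_syzygy (fun b => basis_coord basisB b' (y b - z b))) => //.
under eq_bigr do rewrite mulrC -basis_coordZ scalerBr.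
by rewrite -basis_coord_sum sumrB -dE -zE subrr linear0.
Qed.

(** Write h_i for the homotopy of the multiplication by f_i, the i-th
    generator.  The elements w_k = h_k ... h_1 e, which represent products in
    the algebra Tor(R/I, R/I), satisfy
      d w_k = f_k w_(k-1) + a combination of f_1, ..., f_(k-1),
    so if w_k were in IF, then w_(k-1) would be too, and finally e. *)
Lemma homotopy_chain k : (k < size t)%N ->
  exists (w : F k.+1) (y : F 1%N -> F k), ~ smul_set [set` I] w /\
    res_diff F k w = \sum_(b <- take k.+1 t) diff1 b *: y b.
Proof.
have annI b y : diff1 b *: (y : {ideal_quot I}) = 0.
  exact/quot_annihilated/mem_diff1.
have boundary i (w : F i.+1) (y : F 1%N -> F i) j :
    res_diff F i w = \sum_(b <- take j t) diff1 b *: y b ->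
    smul_set [set` I] w -> forall b, b \in take j t -> smul_set [set` I] (y b).
  (* Padding by 0 turns the partial sum into one over all the generators. *)
  move=> dE Iw b bj; pose y' b := if b \in take j t then y b else 0.
  have -> : y b = y' b by rewrite /y' bj.
  apply: (boundary_coefficients Iw) => //; last exact: mem_take bj.
  rewrite dE (@big_sub_uniq _ _ (take j t) t) //.
  - by apply: eq_big_seq => c cj; rewrite /y' cj.
  - exact: take_uniq.
  - by move=> c; apply: mem_take.
  - by move=> c /negPf cj; rewrite /y' cj scaler0.
elim: k => [|k IH] lt_k.
  case: t lt_k boundary => [//|b t'] _ boundary.
  have [h hE] := homotopy0 freeF (annI b).
  have dE : res_diff F 0%N (h e) = \sum_(c <- take 1 (b :: t')) diff1 c *: e.
    by rewrite /= take0 big_seq1 hE.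
  exists (h e), (fun=> e); split=> // /(boundary _ _ _ _ dE)/(_ b) Ie.
  apply: nI1; have /(smul_set_coord basis0 _ iI)/(_ e erefl) : smul_set [set` I] e.
    by apply: Ie; rewrite /= inE eqxx.
  by rewrite basis_coord_delta // eqxx.
have [w [y [nw dE]]] := IH (ltnW lt_k).
pose b := nth 0 t k.+1; have [h [h' hE]] := homotopy freeF (annI b) k.
(* Since d h' = diff1 b - h d, the earlier coefficients are mapped by - h. *)
have tE : take k.+2 t = rcons (take k.+1 t) b by rewrite (take_nth 0).
have bt : b \notin take k.+1 t.
  have := take_uniq k.+2 ut; rewrite tE rcons_uniq.
  by case/andP.
pose y' c := if c == b then w else - h (y c).
have dE' : res_diff F k.+1 (h' w) = \sum_(c <- take k.+2 t) diff1 c *: y' c.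
  rewrite hE dE linear_sum tE -cats1 big_cat big_seq1 /= {2}/y' eqxx addrC.
  congr (_ + _); rewrite -sumrN; apply: eq_big_seq => c ct.
  rewrite linearZ /= /y'; case: eqP => [cb|_]; last by rewrite scalerN.
  by rewrite -cb ct in bt.
exists (h' w), y'; split=> // /(boundary _ _ _ _ dE')/(_ b) Iw.
by apply: nw; move: Iw; rewrite /y' eqxx; apply; rewrite tE mem_rcons inE eqxx.
Qed.

Lemma res_rank_neq0 : exists w : F (size t), w <> 0.
Proof.
have [n nE] : exists n, n = size t by exists (size t).
rewrite -nE; case: n nE => [|n] nE; last first.
  have [|w [_ [nw _]]] := @homotopy_chain n; first by rewrite -nE.
  by exists w => w0; apply: nw; rewrite w0; apply: smul_set0.
exists e => e0; have := oner_neq0 R; case/eqP.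
have <- : basis_coord basis0 e e = 1 :> R by rewrite basis_coord_delta // eqxx.
by rewrite [X in basis_coord _ _ X]e0 linear0.
Qed.

(** As F is finite, res_rank_neq0 yields a p, at least the number of
    generators, with F_p nonzero and F_(p+1) = 0.  Then I has depth at least p
    by depth_resolution, so regular_generators applies. *)
Lemma weak_ci_regular N : noetherian_ring R ->
  (forall i, (N < i)%N -> forall x : F i, x = 0) ->
  complete_intersection_ideal I /\
  locally_regular [set` I] [set 0] (rev (map diff1 t)).
Proof.
move=> noethR vanF.
have [p [np [[w nw] F0]]] : exists p, (size t <= p)%N /\
    ((exists w : F p, w <> 0) /\ forall x : F p.+1, x = 0).
  suff gen m q : (size t <= q)%N -> (exists w : F q, w <> 0) -> (N < q + m)%N ->
      exists p, (size t <= p)%N /\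
        ((exists w : F p, w <> 0) /\ forall x : F p.+1, x = 0).
    by apply: (gen N.+1 (size t)) => //; [exact: res_rank_neq0|rewrite addnS ltnS leq_addl].
  elim: m q => [|m IH] q tq [w nw] ltN.
    by case: nw; apply: vanF; rewrite addn0 in ltN.
  have [F0|/existsNP nF] := pselect (forall x : F q.+1, x = 0).
    by exists q; split=> //; split=> //; exists w.
  by apply: (IH q.+1); [exact: leqW|exact: nF|rewrite addSnnS].
have := @regular_generators _ noethR _ iI p (map diff1 t) [::].
case=> [s rs sI sp y|//|||[z [/= rz zE]] lz] //.
- exact: (depth_resolution freeF iI dF nw F0).
- by rewrite -ideal_genE ideal_diff1.
- by rewrite /= size_map.
split=> //; exists z; rewrite ideal_genE; split=> //; apply/regular_sequenceE.
by split=> //; rewrite ideal_genE -zE.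
Qed.

End QuotientResolution.

(** * Homogeneous components *)

Section Components.
Variables (V : zmodType) (G : int -> set V).
Hypothesis gradG : grading G.

Lemma grading0 i : G i 0. Proof. by case: gradG => /(_ i)[]. Qed.

Lemma gradingB i x y : G i x -> G i y -> G i (x - y).
Proof. by case: gradG => /(_ i)[_ GB] _ _; apply: GB. Qed.

Lemma gradingD i x y : G i x -> G i y -> G i (x + y).
Proof.
move=> Gx Gy; rewrite -[y]opprK -[- y]sub0r.
by apply: gradingB => //; apply: gradingB => //; apply: grading0.
Qed.

Lemma grading_sum i (T : eqType) (r : seq T) (f : T -> V) :
  (forall j, j \in r -> G i (f j)) -> G i (\sum_(j <- r) f j).
Proof.
move=> Gf; rewrite big_seq; elim/big_rec: _ => [|j x jr Gx]; first exact: grading0.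
by apply: gradingD => //; apply: Gf.
Qed.

(** The family c is total, and zero off the finite support s, so that c alone
    is determined by x. *)
Definition decomposition x (s : seq int) (c : int -> V) :=
  [/\ uniq s, forall i, G i (c i), forall i, i \notin s -> c i = 0
    & x = \sum_(i <- s) c i].

Lemma decompositionD x s c y t d :
  decomposition x s c -> decomposition y t d ->
  decomposition (x + y) (undup (s ++ t)) (fun i => c i + d i).
Proof.
move=> [us Gc c0 ->] [ut Gd d0 ->]; split=> [|i|i|]; first exact: undup_uniq.
- exact: gradingD.
- by rewrite mem_undup mem_cat negb_or => /andP[/c0-> /d0->]; rewrite addr0.
rewrite big_split /=; congr (_ + _); apply/esym/big_sub_uniq => //;
  rewrite ?undup_uniq // => i it; by rewrite mem_undup mem_cat it ?orbT.
Qed.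

Lemma decomposition_homogeneous i x : G i x ->
  decomposition x [:: i] (fun j => if j == i then x else 0).
Proof.
move=> Gx; split=> // [j|j|]; last by rewrite big_seq1 eqxx.
  by case: eqP => [->|_] //; apply: grading0.
by rewrite inE => /negPf->.
Qed.

Lemma decomposition_exists x : exists sc, decomposition x sc.1 sc.2.
Proof.
case: gradG => _ /(_ x)[s [c [Gc ->]]] _.
elim/big_ind: _ => [|y z [[s1 c1] /= d1] [[s2 c2] /= d2]|i _].
- exists ([::], fun=> 0); split=> //=; first exact: grading0.
  by rewrite big_nil.
- by eexists (_, _); apply: decompositionD d1 d2.
- by eexists (_, _); apply: (decomposition_homogeneous (Gc i)).
Qed.

Lemma decomposition_uniq x s c t d :
  decomposition x s c -> decomposition x t d -> c = d.
Proof.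
move=> [us Gc c0 xs] [ut Gd d0 xt].
have [uu Ge e0] : decomposition (x - x) (undup (s ++ t)) (fun i => c i + - d i).
  apply: decompositionD => //; split=> // [i|i /d0->|]; last 1 first.
  - by rewrite sumrN -xt.
  - by rewrite -sub0r; apply: gradingB => //; apply: grading0.
  - exact: oppr0.
rewrite subrr => /esym sum0; apply/funext => i; apply/eqP; rewrite -subr_eq0.
apply/eqP; have [iu|/e0//] := boolP (i \in undup (s ++ t)).
by case: gradG => _ _ /(_ _ _ uu Ge sum0); apply.
Qed.

Definition component i x : V := (sval (cid (decomposition_exists x))).2 i.

Lemma component_decomposition x :
  exists s, decomposition x s (fun i => component i x).
Proof. by rewrite /component; case: cid => -[s c] /= dx; exists s. Qed.

Lemma component_uniq x s c i : decomposition x s c -> component i x = c i.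
Proof.
have [t dt] := component_decomposition x.
by move=> /(decomposition_uniq dt)/(congr1 (@^~ i)).
Qed.

Lemma component_mem i x : G i (component i x).
Proof. by have [s []] := component_decomposition x. Qed.

Lemma componentD i x y : component i (x + y) = component i x + component i y.
Proof.
have [s ds] := component_decomposition x.
have [t dt] := component_decomposition y.
by rewrite (component_uniq i (decompositionD ds dt)).
Qed.

Lemma component_homogeneous i j x : G j x ->
  component i x = if i == j then x else 0.
Proof. by move=> /decomposition_homogeneous/component_uniq->. Qed.

Lemma component0 i : component i 0 = 0.
Proof. by rewrite (component_homogeneous i (grading0 i)) eqxx. Qed.

Lemma component_sum i (T : Type) (r : seq T) (f : T -> V) :
  component i (\sum_(j <- r) f j) = \sum_(j <- r) component i (f j).
Proof. exact: (big_morph _ (componentD i) (component0 i)). Qed.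

Lemma componentB i x y : component i (x - y) = component i x - component i y.
Proof. by apply/eqP; rewrite eq_sym subr_eq -componentD subrK. Qed.

Lemma homogeneous_component j x :
  (forall i, i != j -> component i x = 0) -> G j x.
Proof.
move=> x0; have [s [_ Gx _ ->]] := component_decomposition x.
apply: grading_sum => i _; have [<-//|/x0->] := eqVneq i j.
exact: grading0.
Qed.

End Components.

(** An additive map of degree j commutes with taking components. *)
Lemma component_morph (V W : zmodType) (G : int -> set V) (H : int -> set W)
    (gradG : grading G) (gradH : grading H) (f : V -> W) j :
  f 0 = 0 -> {morph f : x y / x + y} ->
  (forall i x, G i x -> H (i + j) (f x)) ->
  forall i x, component gradH (i + j) (f x) = f (component gradG i x).
Proof.
move=> f0 fD fGH i x; have [s [_ Gx _ xE]] := component_decomposition gradG x.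
rewrite [in LHS]xE [in RHS]xE (big_morph _ fD f0) !component_sum.
rewrite (big_morph _ fD f0); apply: eq_bigr => l _.
rewrite (component_homogeneous gradH _ (fGH _ _ (Gx l))).
rewrite (component_homogeneous gradG _ (Gx l)) (can_eq (addrK j)).
by case: ifP; rewrite ?f0.
Qed.

(** * Homogeneous ideals of a graded local ring *)

Section GradedRing.
Variables (k : fieldType) (Q : comAlgType k) (G : int -> set Q).
Hypothesis gradQ : algebra_grading G.
Hypothesis noethQ : noetherian_ring Q.

Let gradG : grading G. Proof. by case: gradQ. Qed.

Local Notation comp := (component gradG).

Lemma algebra_gradingM i j x y : G i x -> G j y -> G (i + j) (x * y).
Proof. by case: gradQ => _ GM _; apply: GM. Qed.

Lemma algebra_grading1 : G 0 1.
Proof. by case: gradQ => _ _ /(_ 1); rewrite scale1r. Qed.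

Lemma componentMr j a i x : G j a -> comp (i + j) (x * a) = comp i x * a.
Proof.
move=> Ga; apply: (component_morph gradG gradG (f := fun x => x * a)).
- exact: mul0r.
- by move=> y z; rewrite mulrDl.
- by move=> l y Gy; apply: algebra_gradingM.
Qed.

Definition component_closed (J : set Q) := forall i x, J x -> J (comp i x).

Lemma homogeneous_idealE (I : idealr Q) :
  homogeneous_ideal G I <-> component_closed [set` I].
Proof.
split=> [hI i x /hI[s [c [cI ->]]]|hI x Ix].
  rewrite component_sum; apply: (ideal_sum (is_ideal_idealr I)) => j _.
  have [Gj Ij] := cI j; rewrite (component_homogeneous gradG _ Gj).
  by case: eqP => // _; apply: (ideal0 (is_ideal_idealr I)).
have [s [_ Gx _ xE]] := component_decomposition gradG x.
by exists s, (fun i => comp i x); split=> // i; split=> //; apply: hI.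
Qed.

Lemma component_closed_adjoin J j a : is_ideal J -> component_closed J ->
  G j a -> component_closed (adjoin J a).
Proof.
move=> iJ hJ Ga i x [c Jc]; exists (comp (i - j) c).
by rewrite -(componentMr _ _ Ga) subrK -componentB; apply: hJ.
Qed.

Lemma component_closed_zero : component_closed [set 0].
Proof. by move=> i _ ->; rewrite /= component0. Qed.

Variable m : idealr Q.
Hypothesis localm : graded_local_ring G m.

Lemma component_closed_sub_max J : is_ideal J -> component_closed J -> ~ J 1 ->
  J `<=` [set` m].
Proof.
move=> iJ hJ J1; pose P A := [/\ is_ideal A, component_closed A & ~ A 1].
have [||A [[iA hA A1] JA maxA]] := @noetherian_max _ noethQ P J.
- by move=> A [].
- by split.
have [M ME] := idealr_of_set iA A1; rewrite -ME in JA hA maxA.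
suff Mm : M =i m by move=> x /JA; rewrite /= Mm.
case: localm => _; apply; split; first exact/homogeneous_idealE.
move=> N /homogeneous_idealE hN MN.
have NA : [set` N] = [set` M].
  apply: maxA; last by move=> x; apply: MN.
  by split=> //; [exact: is_ideal_idealr|rewrite /= idealr1].
by move=> x; apply/idP/idP => [Nx|/MN//]; have : [set` N] x by []; rewrite NA.
Qed.

(** For r in I of degree 0, 1 + r is a unit: otherwise it generates a proper
    homogeneous ideal, contained, like I, in the maximal one. *)
Lemma degree0_unit (I : idealr Q) u : homogeneous_ideal G I -> G 0 u ->
  [set` I] (u - 1) -> exists v, v * u = 1.
Proof.
move=> /homogeneous_idealE hI Gu Iu; apply: contrapT => nu.
have iI := is_ideal_idealr I; have im := is_ideal_idealr m.
have i0 := is_ideal_zero Q.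
have mI : [set` I] `<=` [set` m].
  by apply: component_closed_sub_max => //; rewrite /= idealr1.
have mu : [set` m] u.
  apply: (@component_closed_sub_max (adjoin [set 0] u)); last exact: adjoin_self.
  - exact: adjoin_ideal.
  - exact: (component_closed_adjoin i0 component_closed_zero Gu).
  - by move=> [v /eqP]; rewrite subr_eq0 => /eqP uv; apply: nu; exists v.
have : [set` m] 1 by rewrite -(subKr u 1); apply: idealB => //; apply: mI.
by rewrite /= idealr1.
Qed.

(** For a homogeneous ideal J and y homogeneous with uy in J, where
    u is in 1 + I, the component of degree 0 of u is a unit which maps y
    into J. *)
Lemma locally_regular_homogeneous (I : idealr Q) J s : homogeneous_ideal G I ->
  is_ideal J -> component_closed J -> [set` s] `<=` homogeneous G ->
  locally_regular [set` I] J s -> regular_mod J s.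
Proof.
move=> hI; elim: s J => [//|a s IH] J iJ hJ hs /= [ra rs].
have [j Ga] : homogeneous G a by apply: hs; rewrite /= inE eqxx.
split; last first.
  apply: IH => //; [exact: adjoin_ideal|exact: component_closed_adjoin Ga|].
  by move=> x xs; apply: hs; rewrite /= inE [_ \in _]xs orbT.
move=> y Jay; have [t [_ Gy _ ->]] := component_decomposition gradG y.
apply: ideal_sum => // i _.
have : locally [set` I] J (comp i y).
  apply: ra; apply: locally_sub; first exact: is_ideal_idealr.
  by rewrite mulrC -(componentMr _ _ Ga) mulrC; apply: hJ.
move=> [u [Iu /(hJ (0 + i))]]; rewrite (componentMr _ _ (Gy i)) => Ju.
have [|v v1] := degree0_unit hI (component_mem gradG 0 u).
  have /eqP <- : comp 0 1 == 1 by rewrite (component_homogeneous _ _ algebra_grading1) eqxx.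
  by rewrite -componentB; apply: (homogeneous_idealE I).1.
by rewrite -[comp i y]mul1r -v1 -mulrA; apply: idealM.
Qed.

End GradedRing.

(** * The theorem *)

(** In a graded resolution of R/I, with F_0 generated by a homogeneous element
    e, the entries of the first differential are homogeneous: the components
    of diff1 b times e are the components of the homogeneous element d b. *)
Lemma diff1_homogeneous (k : fieldType) (Q : comAlgType k) (G : int -> set Q)
    (I : idealr Q) (F : resolution {ideal_quot I})
    (GF : forall i, int -> set (F i))
    (e : F 0%N) (basis0 : is_basis [set e]) (b : F 1%N) :
  algebra_grading G -> module_grading G (GF 0%N) ->
  (forall j x, GF 1%N j x -> GF 0%N j (res_diff F 0 x)) ->
  homogeneous (GF 0%N) e -> homogeneous (GF 1%N) b ->
  homogeneous G (diff1 basis0 b).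
Proof.
move=> gradQ [grad0 GZ] dG [r Ge] [j Gb]; have gradG : grading G by case: gradQ.
exists (j - r); apply: (homogeneous_component (gradG := gradG)) => i ij.
have Gd := dG _ _ Gb; rewrite (res_diff1E basis0) in Gd.
have := component_homogeneous grad0 (i + r) Gd.
have -> : (i + r == j) = false by rewrite eq_sym -subr_eq eq_sym (negPf ij).
rewrite (component_morph gradG grad0 (f := fun x => x *: e)).
- move/(congr1 (basis_coord basis0 e)); rewrite basis_coordZ linear0.
  by rewrite basis_coord_delta // eqxx mulr1.
- exact: scale0r.
- by move=> x y; rewrite scalerDl.
- by move=> l x Gx; apply: GZ.
Qed.

Lemma g_weak_finite_proj_dim (R : comNzRingType) (g : seq R) (M : lmodType R)
    (F : resolution M) : regular_sequence g -> free_resolution F ->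
  diff_lands_in (ideal_gen g) F -> finite_proj_dim M.
Proof.
move=> rg freeF dF; exists F, (size g); split; last exact: g_weak_vanishing.
by move=> i; apply/free_projective/freeF.
Qed.

Lemma graded_free_free (R : comNzRingType) (G : int -> set R) (M : lmodType R)
    (GM : int -> set M) (F : resolution M) :
  graded_free_resolution G GM F -> free_resolution F.
Proof. by move=> [GF [_ basisF _ _]] i; have [B [basisB _]] := basisF i; exists B. Qed.

Lemma diff_lands_in_mono (R : comNzRingType) (M : lmodType R) (F : resolution M)
    (J K : set R) : J `<=` K -> diff_lands_in J F -> diff_lands_in K F.
Proof. by move=> JK dF i x; apply: smul_set_sub (dF i x). Qed.

Theorem proposition2p5 (k : fieldType) (Q : comAlgType k) (g : seq Q)
  (noethQ : noetherian_ring Q) (regg : regular_sequence g) :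
  (* local case *)
  (forall m : idealr Q, local_ring m ->
     (forall M : lmodType Q, fin_gen M ->
        g_weak_ci_module g M -> finite_proj_dim M)
     /\
     (forall I : idealr Q, weak_ci_ideal m I ->
        (g_weak_ci_ideal g I <->
         complete_intersection_ideal I /\ [set` I] `<=` ideal_gen g)))
  /\
  (* graded case *)
  (forall G : int -> set Q, algebra_grading G -> [set` g] `<=` homogeneous G ->
     (forall (M : lmodType Q) (GM : int -> set M),
        module_grading G GM -> fin_gen M ->
        graded_g_weak_ci_module G g GM -> finite_proj_dim M)
     /\
     (forall m : idealr Q, graded_local_ring G m ->
        forall I : idealr Q, homogeneous_ideal G I ->
        graded_weak_ci_ideal G m I ->
        (graded_g_weak_ci_ideal G g I <->
         graded_complete_intersection_ideal G I
         /\ [set` I] `<=` ideal_gen g))).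
Proof.
have iG := ideal_gen_is_ideal g; split.
  move=> m _; split=> [M _ [F [freeF dF]]|I [F [[freeF _] dF]]].
    exact: g_weak_finite_proj_dim dF.
  have fF : free_resolution F by move=> i; case: (freeF i).
  split=> [[F' [freeF' dF']]|[_ sub]]; last first.
    by exists F; split=> //; apply: diff_lands_in_mono dF.
  have sub := diff_lands_in_sub freeF' iG dF'; split=> //.
  have [[B0 basis0] _] := freeF 0%N; have [[B1 basis1] fg1] := freeF 1%N.
  have [e eB] := rank_res0 dF basis0; rewrite eB in basis0.
  have [t [ut tB]] := finite_basis basis1 fg1; rewrite -tB in basis1.
  have [|] := weak_ci_regular fF dF basis0 ut basis1 noethQ (N := size g);
    last by [].
  by apply: g_weak_vanishing => //; apply: diff_lands_in_mono dF.
move=> G gradQ _; split=> [M GM _ _ [F [freeF dF]]|m localm I hI [F [gF [freeF _] dF]]].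
  exact: g_weak_finite_proj_dim (graded_free_free freeF) dF.
have fF := graded_free_free gF.
split=> [[F' [/graded_free_free freeF' dF']]|[_ sub]]; last first.
  by exists F; split=> //; apply: diff_lands_in_mono dF.
have sub := diff_lands_in_sub freeF' iG dF'; split=> //.
have [GF [GFm basisF dGF _]] := gF.
have [B0 [basis0 hB0]] := basisF 0%N; have [B1 [basis1 hB1]] := basisF 1%N.
have [e eB] := rank_res0 dF basis0; rewrite eB in basis0 hB0.
have [t [ut tB]] := finite_basis basis1 (freeF 1%N).2; rewrite -tB in basis1 hB1.
have [|_ lt] := weak_ci_regular fF dF basis0 ut basis1 noethQ (N := size g).
  by apply: g_weak_vanishing => //; apply: diff_lands_in_mono dF.
pose f := rev (map (diff1 basis0) t).
have hf : [set` f] `<=` homogeneous G.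
  move=> x /=; rewrite mem_rev => /mapP[b bt ->].
  exact: (diff1_homogeneous (GF := GF) basis0 gradQ (GFm 0%N) (dGF 0%N)
    (hB0 e erefl) (hB1 b bt)).
have fE : [set` I] = ideal_gen f.
  rewrite (ideal_diff1 dF basis0 ut basis1).
  have iH s := @ideal_gen_is_ideal Q s.
  by apply/seteqP; split; apply: ideal_gen_min => // x xs; apply: ideal_gen_mem;
    move: xs; rewrite /= mem_rev.
exists f; split=> //; apply/regular_sequenceE; split; last by rewrite -fE /= idealr1.
exact: (locally_regular_homogeneous noethQ localm hI (is_ideal_zero Q)
  (component_closed_zero gradQ) hf lt).
Qed.
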